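(* Let $n \le 4$, let $\Omega \subset \mathbb{R}^n$ be a bounded open set, let $f \in L^2(\Omega)$, and let $\lambda \in \mathbb{R}$ satisfy $\lambda < \lambda_1$, where $\lambda_1$ is the first eigenvalue of the Dirichlet problem for $-\Delta$ on $\Omega$. Then the boundary value problem $-\Delta u - \lambda u + u^3 = f$ in $\Omega$, $u = 0$ on $\partial\Omega$, has a weak solution, i.e. there exists $u \in H^1_0(\Omega)$ such that $$\int_\Omega \nabla u \cdot \nabla v \, dx - \lambda \int_\Omega u v \, dx + \int_\Omega u^3 v \, dx = \int_\Omega f v \, dx \qquad \text{for every } v \in H^1_0(\Omega).$$
   Context: All functions are real-valued. $H^1_0(\Omega)$ is the closure of $C_c^\infty(\Omega)$ in the Sobolev space $H^1(\Omega)$. The number $\lambda_1 > 0$ is characterized by the Rayleigh quotient: $\lambda_1 = \inf\{ \int_\Omega |\nabla v|^2 dx / \int_\Omega |v|^2 dx : v \in H^1_0(\Omega),\ v \neq 0 \}$. Since $n \le 4$, one has $H^1_0(\Omega) \subset L^4(\Omega)$, so the integral $\int_\Omega u^3 v\,dx$ is well defined for $u, v \in H^1_0(\Omega)$. *)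

(* Defs.v *)
From HB Require Import structures.
From mathcomp Require Import all_boot all_order all_algebra.
From mathcomp Require Import all_classical all_reals all_analysis.

Set Implicit Arguments.
Unset Strict Implicit.
Unset Printing Implicit Defensive.

Import Order.TTheory GRing.Theory Num.Theory.
Import numFieldNormedType.Exports.

Local Open Scope classical_set_scope.
Local Open Scope ring_scope.

(* R^n is 'rV[R]_n. Its topology and its bounded sets come from the library's
   (max) norm; its sigma-algebra is generated by the coordinates, as for
   n.-tuple in the library, and is hence the Borel one. *)

Definition rV_display : measure_display.
Proof. exact: default_measure_display. Qed.

Section measurable_rV.
Context {R : realType} (n : nat).

Let coord (i : 'I_n) (x : 'rV[R]_n) : measurableTypeR R := x ord0 i.

Let rV_set0 : g_sigma_preimage coord set0.
Proof. exact: sigma_algebra0. Qed.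

Let rV_setC A : g_sigma_preimage coord A -> g_sigma_preimage coord (~` A).
Proof. exact: sigma_algebraC. Qed.

Let rV_bigcup (F : _^nat) : (forall i, g_sigma_preimage coord (F i)) ->
  g_sigma_preimage coord (\bigcup_i (F i)).
Proof. exact: sigma_algebra_bigcup. Qed.

HB.instance Definition _ := @isMeasurable.Build rV_display
  'rV[R]_n (g_sigma_preimage coord) rV_set0 rV_setC rV_bigcup.

Lemma measurable_rV_coord (i : 'I_n) :
  measurable_fun [set: 'rV[R]_n] (fun x => x ord0 i : measurableTypeR R).
Proof.
move=> _ Y mY; rewrite setTI; apply: sub_sigma_algebra => /=.
rewrite -bigcup_seq/=; exists i => /=; first by rewrite mem_index_enum.
by exists Y => //; rewrite setTI.
Qed.

Lemma measurable_fun_rV d (T : measurableType d) (f : T -> 'rV[R]_n) :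
  (forall i, measurable_fun [set: T] (fun x => f x ord0 i : measurableTypeR R)) ->
  measurable_fun [set: T] f.
Proof.
move=> mf _ A mA; rewrite setTI.
suff : preimage_set_system [set: T] f (g_sigma_preimage coord) `<=` measurable.
  by apply; exists A => //; rewrite setTI.
rewrite -g_sigma_preimage_comp.
apply: smallest_sub; first exact: sigma_algebra_measurable.
rewrite -bigcup_seq; apply: bigcup_sub => i _.
by move=> B [C mC <-]; exact: mf.
Qed.

End measurable_rV.

Section lebesgue_rV.
Context {R : realType}.

Definition rV_cons (n : nat) (p : measurableTypeR R * 'rV[R]_n) : 'rV[R]_n.+1 :=
  row_mx (p.1%:M : 'rV[R]_1) p.2.

Definition rV_uncons (n : nat) (x : 'rV[R]_n.+1) :
    measurableTypeR R * 'rV[R]_n :=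
  (x ord0 ord0, rsubmx (x : 'rV[R]_(1 + n))).

Lemma rV_consK n : cancel (@rV_cons n) (@rV_uncons n).
Proof.
move=> [x y]; rewrite /rV_uncons /rV_cons /= row_mxKr; congr (_, _).
have ord0E : (ord0 : 'I_n.+1) = lshift n (ord0 : 'I_1) by exact: val_inj.
by rewrite [X in fun_of_matrix _ _ X]ord0E (@row_mxEl _ 1 1 n) mxE eqxx.
Qed.

Lemma measurable_rV_cons n : measurable_fun setT (@rV_cons n).
Proof.
apply: measurable_fun_rV => i; case: (@split_ordP 1 n i) => j -> {i}.
- rewrite (_ : (fun _ => _) = fst); first exact: measurable_fst.
  by apply/funext => p; rewrite /rV_cons (@row_mxEl _ 1 1 n) mxE (ord1 j) eqxx.
- rewrite (_ : (fun _ => _) = (fun x : 'rV[R]_n => x ord0 j) \o snd).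
    by apply: measurableT_comp => //; exact: measurable_rV_coord.
  by apply/funext => p /=; rewrite /rV_cons (@row_mxEr _ 1 1 n).
Qed.

Lemma measurable_rV_uncons n : measurable_fun setT (@rV_uncons n).
Proof.
apply/measurable_fun_pairP; split => /=; first exact: measurable_rV_coord.
apply: measurable_fun_rV => i.
rewrite (_ : (fun _ => _) = (fun x : 'rV[R]_n.+1 => x ord0 (rshift 1 i))).
  exact: measurable_rV_coord.
by apply/funext => x /=; rewrite mxE.
Qed.

Section step.
Context (n : nat) (mu : {sigma_finite_measure set 'rV[R]_n -> \bar R}).
Local Open Scope ereal_scope.

Let product : {measure set (measurableTypeR R * 'rV[R]_n)%type -> \bar R} :=
  @lebesgue_measure R \x mu.

Definition lebesgue_rV_step : set 'rV[R]_n.+1 -> \bar R :=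
  pushforward product (@rV_cons n).

Let step_measure : {measure set 'rV[R]_n.+1 -> \bar R} :=
  measure_function_pushforward__canonical__measure_function_Measure
    product (@measurable_rV_cons n).

HB.instance Definition _ := isMeasure.Build _ _ _ lebesgue_rV_step
  (measure0 step_measure) (measure_ge0 step_measure)
  (@measure_semi_sigma_additive _ _ _ step_measure).

Let step_sigma_finite : sigma_finite setT lebesgue_rV_step.
Proof.
have /sigma_finiteP[F [TF ndF Foo]] := sigma_finiteT (@lebesgue_measure R).
have /sigma_finiteP[G [TG ndG Goo]] := sigma_finiteT mu.
exists (fun k => @rV_uncons n @^-1` (F k `*` G k)).
  rewrite -preimage_bigcup (_ : \bigcup_k _ = setT) ?preimage_setT//.
  apply/seteqP; split => // -[x y] _.
  have [i _ Fix] : (\bigcup_i F i) x by rewrite -TF.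
  have [j _ Gjy] : (\bigcup_i G i) y by rewrite -TG.
  exists (maxn i j) => //; split.
    by move: x Fix; exact/subsetPset/ndF/leq_maxl.
  by move: y Gjy; exact/subsetPset/ndG/leq_maxr.
move=> k; have [mF F_fin] := Foo k; have [mG G_fin] := Goo k; split.
  rewrite -[X in measurable X]setTI; apply: measurable_rV_uncons => //.
  exact: measurableX.
rewrite /lebesgue_rV_step /pushforward -comp_preimage.
rewrite (_ : _ \o _ = id); last by apply/funext => x; exact: rV_consK.
rewrite preimage_id [ltLHS]product_measure1E//.
by rewrite lte_mul_pinfty// ge0_fin_numE.
Qed.

HB.instance Definition _ := Measure_isSigmaFinite.Build _ _ _
  lebesgue_rV_step step_sigma_finite.

End step.

(* Lebesgue measure on R^n, as the n-fold product of the one on R; on the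
   one-point space R^0 it is the Dirac mass. *)
Fixpoint lebesgue_rV (n : nat) : {sigma_finite_measure set 'rV[R]_n -> \bar R} :=
  match n with
  | 0 => \d_(0 : 'rV[R]_0)
  | m.+1 => lebesgue_rV_step (lebesgue_rV m)
  end.

End lebesgue_rV.

Section smooth.
Context {R : realType} {n : nat}.
Implicit Types (f : 'rV[R]_n -> R) (Omega : set 'rV[R]_n).

Definition partial (i : 'I_n) f : 'rV[R]_n -> R := 'D_(delta_mx ord0 i) f.

Fixpoint is_Ck (k : nat) f : Prop :=
  match k with
  | 0 => continuous f
  | m.+1 => continuous f /\
      forall i : 'I_n,
        (forall x, derivable f x (delta_mx ord0 i)) /\ is_Ck m (partial i f)
  end.

Definition is_smooth f := forall k, is_Ck k f.

(* C_c^oo(Omega), each function being extended by 0 outside Omega *)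
Definition Cc_smooth Omega : set ('rV[R]_n -> R) :=
  [set phi | [/\ is_smooth phi,
                 compact (closure [set x | phi x != 0]) &
                 closure [set x | phi x != 0] `<=` Omega]].

End smooth.

Section sobolev.
Context {R : realType} {n : nat}.
Implicit Types Omega : set 'rV[R]_n.

(* A function on Omega is represented by a total function whose values outside
   Omega are irrelevant. *)
Definition L2 Omega : set ('rV[R]_n -> R) :=
  [set f | f \_ Omega \in Lfun (lebesgue_rV n) 2%:E].

Definition is_weak_partial Omega (i : 'I_n) (u g : 'rV[R]_n -> R) :=
  forall phi, Cc_smooth Omega phi ->
    \int[lebesgue_rV n]_(x in Omega) (u x * partial i phi x) =
    - \int[lebesgue_rV n]_(x in Omega) (g x * phi x).

(* Weak partial derivatives are unique up to a.e. equality; an element of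
   H^1(Omega) comes with a choice of representatives of them. *)
Record H1 Omega := MkH1 {
  H1_fun :> 'rV[R]_n -> R ;
  weak_partial : 'I_n -> 'rV[R]_n -> R ;
  H1_L2 : L2 Omega H1_fun ;
  weak_partial_L2 : forall i, L2 Omega (weak_partial i) ;
  weak_partialP : forall i, is_weak_partial Omega i H1_fun (weak_partial i)
}.

(* The H^1 norm of a function w with partial derivatives g *)
Definition H1_norm Omega (w : 'rV[R]_n -> R) (g : 'I_n -> 'rV[R]_n -> R) : R :=
  Num.sqrt (\int[lebesgue_rV n]_(x in Omega) (w x ^+ 2) +
            \sum_(i < n) \int[lebesgue_rV n]_(x in Omega) (g i x ^+ 2)).

(* The closure of C_c^oo(Omega) in H^1(Omega) *)
Definition H10 Omega : set (H1 Omega) :=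
  [set u : H1 Omega | forall e : R, 0 < e ->
     exists2 phi, Cc_smooth Omega phi &
       H1_norm Omega (fun x => u x - phi x)
         (fun i x => weak_partial u i x - partial i phi x) < e].

(* The first Dirichlet eigenvalue of -Delta, through its Rayleigh quotient; it
   is +oo when Omega is empty. *)
Definition lambda1 Omega : \bar R :=
  ereal_inf [set ((\int[lebesgue_rV n]_(x in Omega)
                     (\sum_(i < n) weak_partial v i x ^+ 2)) /
                  (\int[lebesgue_rV n]_(x in Omega) (v x ^+ 2)))%:E
            | v in [set v : H1 Omega | H10 v /\
                ~ {ae lebesgue_rV n, forall x, Omega x -> v x = 0}]].

End sobolev.

(* Main.v *)
(* The functional J(v) = (|grad v|^2 - lambda |v|^2)/2 + |v^2|^2/4 - (f, v) is
   uniformly convex on C_c^oo(Omega) in the H^1 norm, because lambda < lambda1,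
   so a minimizing sequence phi_k of test functions is Cauchy in H^1 and no
   compactness is needed. Its limit u lies in H^1_0 and, by Fatou, in L^4, and
   it satisfies the weak equation against test functions.

   Test functions are extended to v in H^1_0 by a Kato-type estimate rather
   than by the Sobolev embedding: testing the equation with approximations of
   sgn(u) |v| gives int |u|^3 |v| <= c |v|_{H^1}, since the gradient terms that
   contain |grad u|^2 have a favourable sign. *)

Require Import Defs.
From mathcomp Require Import all_boot all_order all_algebra.
From mathcomp Require Import all_classical all_reals all_analysis.
From mathcomp Require Import measurable_realfun.
From mathcomp Require Import ring lra.

Import Order.TTheory GRing.Theory Num.Theory.
Import numFieldNormedType.Exports.

Local Open Scope classical_set_scope.
Local Open Scope ring_scope.

Set Implicit Arguments.
Unset Strict Implicit.
Unset Printing Implicit Defensive.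

(** Rates replace subsequences. Values of J within 4^-k of the infimum make the H^1 norm of
    phi_(k+1) - phi_k of order 2^-k; this is summable, so the whole sequence converges almost
    everywhere as well as in L^2, and each error made later by using phi_k for u is again O(2^-k).

    The obstacle is the cubic term. Fatou puts u in L^4 only, while v is merely an H^1 limit of test
    functions, so neither the integrability of u^3 v nor the convergence of the cubic integrals
    along test functions is evident. Since sgn(u) |v| is not a test function, sgn(u) becomes phi_k /
    sqrt (1 + phi_k^2) and |v| becomes sqrt (1 + v^2) - 1. This smoothing loses at most |u| |v| +
    |u|^3 pointwise. The first loss has an L^2 bound; the second does not depend on v, while all
    other terms are homogeneous of degree one in v, so replacing v by K v with K large removes
    it. *)

Lemma cvg_dist_le (R : realType) (f e : nat -> R) a :
  (forall k, `|f k - a| <= e k) -> e @ \oo --> 0 -> f @ \oo --> a.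
Proof.
move=> fe /cvgr0_norm_le e0; apply/cvgrPdist_le => eps /e0.
apply: filterS => k; rewrite distrC; apply: le_trans.
exact: le_trans (fe k) (ler_norm _).
Qed.

Lemma cvg_EFin_seq (R : realType) (f : nat -> R) a :
  f @ \oo --> a -> (fun k => (f k)%:E) @ \oo --> a%:E.
Proof. by move=> fa; apply: cvg_EFin => //; exact: nearW. Qed.

(** At (s, t) = (b, a) the form equals 2 a b (a b - c), which settles the case a b > 0. If a or b
    vanishes, a positive c is refuted by weighting the cross term until it outweighs the remaining
    square. *)
Lemma discriminant_le (R : realFieldType) (a b c : R) : 0 <= a -> 0 <= b ->
  (forall s t, 0 <= s ^+ 2 * a ^+ 2 - 2 * s * t * c + t ^+ 2 * b ^+ 2) ->
  c <= a * b.
Proof.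
move=> a0 b0 P.
have [b0'|b0'] := eqVneq b 0.
  rewrite b0' mulr0.
  rewrite leNgt; apply/negP => c0.
  have := P 1 ((a ^+ 2 + 1) / c); rewrite b0'.
  have -> : 2 * 1 * ((a ^+ 2 + 1) / c) * c = 2 * (a ^+ 2 + 1).
    by field; rewrite gt_eqF.
  by have := sqr_ge0 a; lra.
have [a0'|a0'] := eqVneq a 0.
  rewrite a0' mul0r leNgt; apply/negP => c0.
  have := P ((b ^+ 2 + 1) / c) 1; rewrite a0'.
  have -> : 2 * ((b ^+ 2 + 1) / c) * 1 * c = 2 * (b ^+ 2 + 1).
    by field; rewrite gt_eqF.
  by have := sqr_ge0 b; lra.
have ab : 0 < a * b by rewrite mulr_gt0 // lt_neqAle eq_sym ?a0' ?b0'.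
rewrite -(ler_pM2l ab); have := P b a; nra.
Qed.

(** * Square-integrable functions *)

Section square_integrable.
Context d (T : measurableType d) (R : realType).
Variables (mu : {measure set T -> \bar R}) (D : set T) (mD : measurable D).
Implicit Types (f g h : T -> R) (a : R).

Local Notation intg f := (mu.-integrable D (fun x => (f x)%:E)).
Local Notation int f := (\int[mu]_(x in D) f x).

Lemma intg_measurable f : intg f -> measurable_fun D f.
Proof. by move=> /measurable_int /measurable_EFinP. Qed.

Lemma le_intg f g : measurable_fun D f ->
  (forall x, D x -> `|f x| <= g x) -> intg g -> intg f.
Proof.
move=> mf fg; apply: le_integrable => //; first exact/measurable_EFinP.
by move=> x Dx; rewrite /= lee_fin (le_trans (fg x Dx))// ler_norm.
Qed.

Lemma intgD f g : intg f -> intg g -> intg (fun x => f x + g x).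
Proof. by move=> fi gi; have := integrableD mD fi gi. Qed.

Lemma intgB f g : intg f -> intg g -> intg (fun x => f x - g x).
Proof. by move=> fi gi; have := integrableB mD fi gi. Qed.

Lemma intgZ a f : intg f -> intg (fun x => a * f x).
Proof. by move=> fi; have := integrableZl mD a fi. Qed.

Lemma intg_norm f : intg f -> intg (fun x => `|f x|).
Proof. by move=> fi; have := integrable_norm fi. Qed.

Lemma intg_sum I (s : seq I) (h : I -> T -> R) :
  (forall i, intg (h i)) -> intg (fun x => \sum_(i <- s) h i x).
Proof.
move=> hi; elim: s => [|i s ih].
  by under eq_fun do rewrite big_nil; exact: integrable0.
by under eq_fun do rewrite big_cons; exact: intgD.
Qed.

Lemma Rintegral_sum I (s : seq I) (h : I -> T -> R) :
  (forall i, intg (h i)) ->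
  int (fun x => \sum_(i <- s) h i x) = \sum_(i <- s) int (h i).
Proof.
move=> hi; elim: s => [|i s ih].
  under eq_Rintegral do rewrite big_nil.
  by rewrite big_nil Rintegral_cst// mul0r.
under eq_Rintegral do rewrite big_cons.
rewrite RintegralD//= ?ih ?big_cons//; first exact: hi.
exact: (@intg_sum _ s).
Qed.

(** L^2(D) for functions rather than classes. Measurability of [f] is a separate clause because it
    does not follow from that of its square. *)
Definition sqi f := measurable_fun D f /\ intg (fun x => f x ^+ 2).
Definition nrm2 f := Num.sqrt (int (fun x => f x ^+ 2)).

Lemma nrm2_ge0 f : 0 <= nrm2 f. Proof. exact: sqrtr_ge0. Qed.

Lemma int_sq_ge0 f : 0 <= int (fun x => f x ^+ 2).
Proof. by apply: Rintegral_ge0 => x _; exact: sqr_ge0. Qed.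

Lemma sqr_nrm2 f : nrm2 f ^+ 2 = int (fun x => f x ^+ 2).
Proof. by rewrite sqr_sqrtr// int_sq_ge0. Qed.

Lemma eq_nrm2 f g : {in D, f =1 g} -> nrm2 f = nrm2 g.
Proof.
by move=> fg; congr Num.sqrt; apply: eq_Rintegral => x xD; rewrite fg.
Qed.

Lemma sqi_mul f g : sqi f -> sqi g -> intg (fun x => f x * g x).
Proof.
move=> [mf fi] [mg gi]; apply: le_intg (intgD fi gi).
  exact: measurable_funM.
move=> x _; have [] := (sqr_ge0 (f x + g x), sqr_ge0 (f x - g x)).
by rewrite ler_norml => ? ?; apply/andP; split; nra.
Qed.

Lemma sqiD f g : sqi f -> sqi g -> sqi (fun x => f x + g x).
Proof.
move=> [mf fi] [mg gi]; split; first exact: measurable_funD.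
apply: le_intg (intgD (intgZ 2 fi) (intgZ 2 gi)).
  by apply: measurable_funX; exact: measurable_funD.
move=> x _; rewrite ger0_norm ?sqr_ge0//.
by have := sqr_ge0 (f x - g x); nra.
Qed.

Lemma sqi_le f g : measurable_fun D f -> (forall x, D x -> `|f x| <= `|g x|) ->
  sqi g -> sqi f.
Proof.
move=> mf fg [mg gi]; split => //; apply: le_intg gi.
  exact: measurable_funX.
move=> x Dx; rewrite ger0_norm ?sqr_ge0// -[leLHS]real_normK ?num_real//.
by rewrite -[leRHS]real_normK ?num_real// lerXn2r ?nnegrE ?normr_ge0// fg.
Qed.

Lemma nrm2_le f g : measurable_fun D f -> (forall x, D x -> `|f x| <= `|g x|) ->
  sqi g -> nrm2 f <= nrm2 g.
Proof.
move=> mf fg sg; have [_ fi] := sqi_le mf fg sg; case: sg => [mg gi].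
rewrite ler_wsqrtr// le_Rintegral// => x Dx.
rewrite -[leLHS]real_normK ?num_real//.
by rewrite -[leRHS]real_normK ?num_real// lerXn2r ?nnegrE ?normr_ge0// fg.
Qed.

Lemma sqiZ a f : sqi f -> sqi (fun x => a * f x).
Proof.
move=> [mf fi]; split; first exact: measurable_funM.
by under eq_fun do rewrite exprMn; exact: intgZ.
Qed.

Lemma nrm2Z a f : sqi f -> nrm2 (fun x => a * f x) = `|a| * nrm2 f.
Proof.
move=> [mf fi]; rewrite /nrm2.
under eq_Rintegral do rewrite exprMn.
by rewrite RintegralZl//= sqrtrM ?sqr_ge0// sqrtr_sqr.
Qed.

Lemma sqiN f : sqi f -> sqi (fun x => - f x).
Proof.
by move=> sf; under eq_fun do rewrite -mulN1r; exact: sqiZ.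
Qed.

Lemma nrm2N f : nrm2 (fun x => - f x) = nrm2 f.
Proof. by rewrite /nrm2; under eq_Rintegral do rewrite sqrrN. Qed.

Lemma sqiB f g : sqi f -> sqi g -> sqi (fun x => f x - g x).
Proof. by move=> sf sg; apply: sqiD => //; exact: sqiN. Qed.

Lemma sqi_norm f : sqi f -> sqi (fun x => `|f x|).
Proof.
move=> sf; apply: sqi_le (sf); first exact: measurableT_comp sf.1.
by move=> x _; rewrite normr_id.
Qed.

Lemma nrm2_norm f : nrm2 (fun x => `|f x|) = nrm2 f.
Proof.
rewrite /nrm2; under eq_Rintegral => x _ do rewrite real_normK ?num_real//.
by [].
Qed.

(** The integral of (s f - t g)^2 is a nonnegative quadratic form in (s, t), so [discriminant_le]
    applies. *)
Lemma cauchy_schwarz f g : sqi f -> sqi g ->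
  int (fun x => f x * g x) <= nrm2 f * nrm2 g.
Proof.
move=> sf sg; have fgi := sqi_mul sf sg.
have P (s t : R) : 0 <= s ^+ 2 * nrm2 f ^+ 2 - 2 * s * t * int (fun x => f x * g x)
    + t ^+ 2 * nrm2 g ^+ 2.
  have := int_sq_ge0 (fun x => s * f x - t * g x).
  have -> : int (fun x => (s * f x - t * g x) ^+ 2) =
            int (fun x => s ^+ 2 * f x ^+ 2 - 2 * s * t * (f x * g x)
              + t ^+ 2 * g x ^+ 2).
    by apply: eq_Rintegral => x _; ring.
  rewrite RintegralD//=; last 2 first.
  - by apply: intgB; apply: intgZ => //; exact: sf.2.
  - by apply: intgZ; exact: sg.2.
  rewrite RintegralB//=; [|by apply: intgZ; exact: sf.2|exact: intgZ].
  by rewrite !RintegralZl//= ?sqr_nrm2//; (exact: sf.2 || exact: sg.2).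
exact: discriminant_le (nrm2_ge0 f) (nrm2_ge0 g) P.
Qed.

Lemma cauchy_schwarz_norm f g : sqi f -> sqi g ->
  `|int (fun x => f x * g x)| <= nrm2 f * nrm2 g.
Proof.
move=> sf sg; apply: (le_trans (le_normr_Rintegral mD (sqi_mul sf sg))).
under eq_Rintegral do rewrite normrM.
by rewrite -(nrm2_norm f) -(nrm2_norm g) cauchy_schwarz//; exact: sqi_norm.
Qed.

Lemma nrm2D f g : sqi f -> sqi g -> nrm2 (fun x => f x + g x) <= nrm2 f + nrm2 g.
Proof.
move=> sf sg; rewrite -(@ler_pXn2r _ 2)// ?nnegrE ?addr_ge0 ?nrm2_ge0//.
have fgi := sqi_mul sf sg.
rewrite sqr_nrm2 (_ : Rintegral _ _ _ =
    int (fun x => f x ^+ 2 + 2 * (f x * g x) + g x ^+ 2)); last first.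
  by apply: eq_Rintegral => x _; ring.
rewrite RintegralD//=; last 2 first.
- by apply: intgD; [exact: sf.2|exact: intgZ].
- exact: sg.2.
rewrite RintegralD//=; [|exact: sf.2|exact: intgZ].
rewrite RintegralZl//= -!sqr_nrm2 sqrrD.
by have := cauchy_schwarz sf sg; lra.
Qed.

Lemma nrm2_dist f g h : sqi f -> sqi g -> sqi h ->
  nrm2 (fun x => f x - h x) <= nrm2 (fun x => f x - g x) + nrm2 (fun x => g x - h x).
Proof.
move=> sf sg sh; apply: le_trans (nrm2D (sqiB sf sg) (sqiB sg sh)).
by rewrite le_eqVlt; apply/orP; left; apply/eqP/eq_nrm2 => x _; ring.
Qed.

Lemma nrm2BC f g : nrm2 (fun x => f x - g x) = nrm2 (fun x => g x - f x).
Proof. by rewrite -nrm2N; apply: eq_nrm2 => x _; rewrite opprB. Qed.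

Lemma intg_bddM h f M : measurable_fun D h -> (forall x, D x -> `|h x| <= M) ->
  intg f -> intg (fun x => h x * f x).
Proof.
move=> mh hM fi; apply: le_intg (intgZ M (intg_norm fi)).
  by apply: measurable_funM => //; exact: intg_measurable.
by move=> x Dx; rewrite normrM ler_wpM2r// hM.
Qed.

Lemma sqi_bddM h f M : measurable_fun D h -> (forall x, D x -> `|h x| <= M) ->
  sqi f -> sqi (fun x => h x * f x).
Proof.
move=> mh hM sf; apply: sqi_le (sqiZ M sf).
  by apply: measurable_funM => //; exact: sf.1.
by move=> x Dx; rewrite !normrM ler_wpM2r// (le_trans (hM x Dx))// ler_norm.
Qed.

Lemma nrm2_bddM h f M : measurable_fun D h -> (forall x, D x -> `|h x| <= M) ->
  0 <= M -> sqi f -> nrm2 (fun x => h x * f x) <= M * nrm2 f.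
Proof.
move=> mh hM M0 sf; rewrite -[in leRHS](ger0_norm M0) -nrm2Z//.
apply: nrm2_le (sqiZ M sf).
  by apply: measurable_funM => //; exact: sf.1.
by move=> x Dx; rewrite !normrM ler_wpM2r// (le_trans (hM x Dx))// ler_norm.
Qed.

Lemma cvg_int_nrm2 (u : nat -> T -> R) f g :
  (forall k, sqi (u k)) -> sqi f -> sqi g ->
  (fun k => nrm2 (fun x => u k x - f x)) @ \oo --> 0 ->
  (fun k => int (fun x => u k x * g x)) @ \oo --> int (fun x => f x * g x).
Proof.
move=> su sf sg uf; apply: (@cvg_dist_le _ _ (fun k => nrm2 (fun x => u k x - f x) * nrm2 g)).
- move=> k; rewrite -RintegralB//=; [|exact: sqi_mul..].
  under eq_Rintegral do rewrite -mulrBl.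
  by apply: cauchy_schwarz_norm => //; exact: sqiB.
- by rewrite -(mul0r (nrm2 g)); apply: cvgM => //; exact: cvg_cst.
Qed.

(** Measurability of [f] is assumed because almost everywhere convergence does not give it for a
    measure that may be incomplete. The bounds [b k] may vary, so that errors tending to 0 can be
    carried along. *)
Lemma fatou_ae (F : nat -> T -> R) f (b : nat -> R) a :
  (forall k, intg (F k)) -> measurable_fun D f ->
  (forall k x, D x -> 0 <= F k x) -> (forall x, D x -> 0 <= f x) ->
  {ae mu, forall x, D x -> F k x @[k --> \oo] --> f x} ->
  (forall k, int (F k) <= b k) -> b @ \oo --> a ->
  intg f /\ int f <= a.
Proof.
move=> Fi mf F0 f0 Ff Fb ba.
have Fab : (\int[mu]_(x in D) (f x)%:E <= a%:E)%E.
  rewrite (_ : (\int[mu]_(x in D) (f x)%:E =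
      \int[mu]_(x in D) limn_einf (fun k => (F k x)%:E))%E); last first.
    apply: ge0_ae_eq_integral => //.
    - exact/measurable_EFinP.
    - rewrite /limn_einf; apply: measurableT_comp => //.
      apply: measurable_fun_limn_esup => k; apply: measurableT_comp => //.
      exact/measurable_EFinP/intg_measurable.
    - move=> x Dx; rewrite limn_einf_lim; apply: lime_ge; first exact: is_cvg_einfs.
      apply: nearW => k; apply: le_ereal_inf_tmp => _ [m _ <-].
      by rewrite /= lee_fin F0.
    - apply: filterS Ff => x Ff Dx.
      by have [->] := cvg_limn_einf_sup (cvg_EFin_seq (Ff Dx)).
  apply: le_trans.
    apply: (@fatou _ _ _ mu D mD (fun k x => (F k x)%:E)).
  - by move=> k; apply/measurable_EFinP/intg_measurable.
  - by move=> k x Dx; rewrite /= lee_fin F0.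
  (* The limit [a] is rewritten as the lower limit of [b], so that the two lower limits can be
     compared through the infima of their tails. *)
  have [+ _] := cvg_limn_einf_sup (cvg_EFin_seq ba).
  move=> <-; rewrite !limn_einf_lim; apply: lee_lim; [exact: is_cvg_einfs..|].
  apply: nearW => k; apply: le_ereal_inf_tmp => _ [m /= km <-].
  apply: ge_ereal_inf; exists (\int[mu]_(x in D) (F m x)%:E)%E; first by exists m.
  have /fineK <- : (\int[mu]_(x in D) (F m x)%:E)%E \is a fin_num.
    exact: integrable_fin_num.
  by rewrite lee_fin; exact: Fb.
have fi : intg f.
  apply/integrableP; split; first exact/measurable_EFinP.
  under eq_integral => x xD do rewrite /= (ger0_norm (f0 x (set_mem xD))).
  by apply: le_lt_trans Fab _; rewrite ltry.
split => //; rewrite -lee_fin; apply: le_trans Fab.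
by rewrite fineK//; exact: integrable_fin_num.
Qed.

End square_integrable.

(** * Completeness of L^2 on a set of finite measure, for geometric rates *)

Section riesz_fischer.
Context d (T : measurableType d) (R : realType).
Variables (mu : {measure set T -> \bar R}) (D : set T) (mD : measurable D).
Hypothesis muD : (mu D < +oo)%E.

Local Notation intg f := (mu.-integrable D (fun x => (f x)%:E)).
Local Notation int f := (\int[mu]_(x in D) f x).
Local Notation nrm2 := (nrm2 mu D).
Local Notation sqi := (sqi mu D).

Lemma intg_cst (a : R) : intg (fun=> a).
Proof.
apply: (measurable_bounded_integrable mD muD) => //.
by exists `|a|; split; [exact: num_real|move=> M /ltW aM x _].
Qed.

Lemma intg_bounded (f : T -> R) M : measurable_fun D f ->
  (forall x, D x -> `|f x| <= M) -> intg f.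
Proof. by move=> mf fM; apply: (le_intg mD mf fM); exact: intg_cst. Qed.

Lemma sqi_bounded (f : T -> R) M : measurable_fun D f ->
  (forall x, D x -> `|f x| <= M) -> sqi f.
Proof.
move=> mf fM; split => //; apply: (@intg_bounded _ (M ^+ 2)).
  exact: measurable_funX.
move=> x Dx; rewrite normrX lerXn2r ?nnegrE ?fM//.
exact: le_trans (fM x Dx).
Qed.

Lemma int_norm_le_nrm2 (f : T -> R) : sqi f ->
  int (fun x => `|f x|) <= nrm2 f * nrm2 (fun=> 1).
Proof.
move=> sf; rewrite -(nrm2_norm mu D f).
under eq_Rintegral do rewrite -[`|_|]mulr1.
apply: cauchy_schwarz => //; first exact: sqi_norm.
by apply: (@sqi_bounded _ 1) => // x _; rewrite normr1.
Qed.

Lemma sqi_intg (f : T -> R) : sqi f -> intg f.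
Proof.
move=> sf; under eq_fun do rewrite -[f _]mulr1.
apply: sqi_mul => //.
by apply: (@sqi_bounded _ 1) => // x _; rewrite normr1.
Qed.

Variables (u : nat -> T -> R) (C : R).
Hypothesis su : forall k, sqi (u k).
Hypothesis uC : forall k, nrm2 (fun x => u k.+1 x - u k x) <= C * 2^-1 ^+ k.

Let C0 : 0 <= C.
Proof. by have := uC 0; rewrite expr0 mulr1; apply: le_trans; exact: nrm2_ge0. Qed.

Let half_ge0 k : 0 <= (2^-1 : R) ^+ k.
Proof. by rewrite exprn_ge0// invr_ge0. Qed.

(** The bound keeps its subtracted tail so that the induction closes: one more increment C 2^-(k+m)
    is exactly the drop of 2 C 2^-(k+m) to 2 C 2^-(k+m+1). *)
Lemma nrm2_geometric k m :
  nrm2 (fun x => u (k + m)%N x - u k x) <= 2 * C * 2^-1 ^+ k - 2 * C * 2^-1 ^+ (k + m).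
Proof.
elim: m => [|m ih].
  rewrite addn0 subrr le_eqVlt; apply/orP; left; apply/eqP.
  rewrite /nrm2; under eq_Rintegral do rewrite subrr expr0n/=.
  by rewrite Rintegral_cst// mul0r sqrtr0.
apply: le_trans (nrm2_dist mD (su _) (su (k + m)%N) (su _)) _.
rewrite addnS; have := uC (k + m); rewrite exprS.
by move: ih; set a := 2^-1 ^+ (k + m); lra.
Qed.

(** On a set of finite measure the L^2 norm controls the L^1 norm, so the sum of the |u_(k+1) - u_k|
    has a finite integral and is finite almost everywhere. There the telescoping series converges
    absolutely. *)
Lemma geometric_ae_cvg : {ae mu, forall x, D x -> cvgn (fun k => u k x)}.
Proof.
pose v k x := `|u k.+1 x - u k x|.
have sv k : sqi (v k) by apply: sqi_norm => //; exact: sqiB.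
have vi k : intg (v k) by exact: sqi_intg.
pose a := C * nrm2 (fun=> 1).
have va k : int (v k) <= a * 2^-1 ^+ k.
  apply: le_trans (int_norm_le_nrm2 _) _; first exact: sqiB.
  by rewrite /a mulrAC ler_wpM2r ?nrm2_ge0 ?uC.
have mv k : measurable_fun D (fun x => (v k x)%:E).
  by apply/measurable_EFinP/intg_measurable.
have v0 k x : D x -> (0 <= (v k x)%:E)%E by rewrite lee_fin normr_ge0.
pose g x := (\sum_(k <oo) (v k x)%:E)%E.
have gi : mu.-integrable D g.
  apply/integrableP; split; first exact: (@ge0_emeasurable_sum _ _ _ D
    (fun k x => (v k x)%:E) xpredT (fun k x Dx _ => v0 k x Dx) (fun k _ => mv k)).
  have g0 x : D x -> (0 <= g x)%E by move=> Dx; apply: nneseries_ge0 => k _ _; exact: v0.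
  rewrite (eq_integral g); last by move=> x /set_mem Dx; rewrite gee0_abs// g0.
  rewrite integral_nneseries//; apply: (@le_lt_trans _ _ (2 * a)%:E); last exact: ltry.
  apply: lime_le; first by apply: is_cvg_nneseries => k _ _; apply: integral_ge0 => x; exact: v0.
  apply: nearW => m; have -> : (\sum_(0 <= k < m) \int[mu]_(x in D) (v k x)%:E =
      (\sum_(0 <= k < m) int (v k))%:E)%E.
    rewrite -sumEFin; apply: eq_bigr => k _; rewrite fineK//.
    exact: integrable_fin_num.
  rewrite lee_fin; have a0 : 0 <= a by rewrite mulr_ge0 ?nrm2_ge0.
  apply: (@le_trans _ _ (2 * a - 2 * a * 2^-1 ^+ m)); last first.
    by rewrite gerBl !mulr_ge0 ?half_ge0 ?C0 ?nrm2_ge0//.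
  elim: m => [|m ih]; first by rewrite big_geq// expr0 mulr1 subrr.
  rewrite big_nat_recr//; apply: le_trans (lerD ih (va m)) _.
  by rewrite exprS; lra.
apply: filterS (integrable_ae mD gi) => x gx Dx.
have {gx}/gx gfin := Dx.
have : cvgn (series (telescope (fun k => u k x))).
  apply: normed_cvg.
  have vx0 n : (0 <= n)%N -> true -> (0 <= (v n x)%:E)%E by move=> _ _; exact: v0.
  have := is_cvg_nneseries vx0; rewrite -/(g x).
  move=> /cvg_ex[l gl]; have lE : l = g x by rewrite /g; apply/esym/cvg_lim.
  apply/cvg_ex; exists (fine l).
  move: gl; rewrite -[l in X in X -> _]fineK ?lE// => /fine_cvgP[_].
  apply: cvg_trans; apply: near_eq_cvg; apply: nearW => n /=.
  rewrite /= sumEFin /=; apply: eq_bigr => k _ ; by [].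
rewrite telescopeK => /cvg_ex[l ul]; apply/cvg_ex; exists (l + u 0 x).
rewrite (_ : (fun k => u k x) = (fun k => (u k x - u 0 x) + u 0 x)).
  by apply: cvgD => //; exact: cvg_cst.
by apply/funext => k; rewrite subrK.
Qed.

(* Taking f to be an upper limit makes it measurable without any appeal to the
   a.e. convergence. *)
Theorem riesz_fischer : exists f, [/\ sqi f,
  {ae mu, forall x, D x -> u k x @[k --> \oo] --> f x} &
  forall k, nrm2 (fun x => u k x - f x) <= 2 * C * 2^-1 ^+ k].
Proof.
pose f x := fine (limn_esup (fun k => (u k x)%:E)).
have mf : measurable_fun D f.
  apply: measurableT_comp => //; apply: measurable_fun_limn_esup => k.
  exact/measurable_EFinP/(su k).1.
have uf : {ae mu, forall x, D x -> u k x @[k --> \oo] --> f x}.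
  apply: filterS geometric_ae_cvg => x ux /ux /cvg_ex[l ul].
  by rewrite /f; have [_ ->] := cvg_limn_einf_sup (cvg_EFin_seq ul).
(* Fatou in m, applied to (u_(k+m) - u_k)^2, turns the Cauchy estimate into the rate towards the
   limit. *)
have main k : intg (fun x => (u k x - f x) ^+ 2) /\
    int (fun x => (u k x - f x) ^+ 2) <= (2 * C * 2^-1 ^+ k) ^+ 2.
  apply: (@fatou_ae _ _ _ _ _ mD (fun m x => (u (k + m)%N x - u k x) ^+ 2) _
    (cst ((2 * C * 2^-1 ^+ k) ^+ 2))).
  - by move=> m; have [] := sqiB mD (su (k + m)%N) (su k).
  - by apply: measurable_funX; apply: measurable_funB => //; exact: (su k).1.
  - by move=> *; exact: sqr_ge0.
  - by move=> *; exact: sqr_ge0.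
  - apply: filterS uf => x /[apply] ux.
    rewrite -(sqrrN (u k x - f x)) opprB.
    apply: (cvg_comp (fun m => u (k + m)%N x - u k x) (fun y => y ^+ 2));
      last exact: exprn_continuous.
    apply: cvgB; last exact: cvg_cst.
    under eq_cvg do rewrite addnC.
    exact: (cvg_comp (addn^~ k) (fun m => u m x) (cvg_addnr k) ux).
  - move=> m; rewrite -sqr_nrm2 lerXn2r ?nnegrE ?nrm2_ge0//.
      by rewrite !mulr_ge0 ?half_ge0 ?C0//.
    apply: le_trans (nrm2_geometric k m) _.
    by rewrite gerBl !mulr_ge0 ?half_ge0 ?C0//.
  - exact: cvg_cst.
have suf k : sqi (fun x => u k x - f x).
  by split; [apply: measurable_funB => //; exact: (su k).1|exact: (main k).1].
exists f; split => //.
- have := sqiB mD (su 0) (suf 0).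
  by congr sqi; apply/funext => x; rewrite subKr.
- move=> k; rewrite -(@ler_pXn2r _ 2)// ?nnegrE ?nrm2_ge0//.
    by rewrite sqr_nrm2; exact: (main k).2.
  by rewrite !mulr_ge0 ?half_ge0 ?C0//.
Qed.

End riesz_fischer.

(** * Calculus of smooth functions *)

Section inverse_japanese_bracket.
Context {R : realType}.

(* The inverse of the Japanese bracket of f. *)
Definition ijb T (f : T -> R) x : R := (Num.sqrt (1 + f x ^+ 2))^-1.

Lemma ijb_gt0 T (f : T -> R) x : 0 < ijb f x.
Proof. by rewrite invr_gt0 sqrtr_gt0 ltr_pwDl// sqr_ge0. Qed.

Lemma ijb_le1 T (f : T -> R) x : ijb f x <= 1.
Proof.
rewrite invf_le1 ?sqrtr_gt0 ?ltr_pwDl ?sqr_ge0//.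
by rewrite -[leLHS]sqrtr1 ler_wsqrtr// lerDl sqr_ge0.
Qed.

(** Later algebra treats s = [ijb f x] through this identity and its bounds, without square roots:
    sqrt (1 + t^2) is written (1 + t^2) s, so its smoothness reduces to that of [ijb]. *)
Lemma sqr_ijb T (f : T -> R) x : (1 + f x ^+ 2) * ijb f x ^+ 2 = 1.
Proof.
have h : 0 < 1 + f x ^+ 2 by rewrite ltr_pwDl// sqr_ge0.
by rewrite exprVn sqr_sqrtr ?ltW// divff// gt_eqF.
Qed.

Lemma continuous_ijb (T : topologicalType) (f : T -> R) : continuous f -> continuous (ijb f).
Proof.
move=> cf x; apply: (@continuousV _ _ (fun x => Num.sqrt (1 + f x ^+ 2))).
  by rewrite gt_eqF// sqrtr_gt0 ltr_pwDl// sqr_ge0.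
apply: (continuous_comp (f := fun x => 1 + f x ^+ 2) (g := Num.sqrt));
  last exact: sqrt_continuous.
apply: continuousD; first exact: cst_continuous.
by apply: (continuous_comp (f := f) (g := fun y => y ^+ 2));
  [exact: cf|exact: exprn_continuous].
Qed.

End inverse_japanese_bracket.

Section smooth_calculus.
Context {R : realType} {n : nat}.
Implicit Types (f g : 'rV[R]_n -> R) (i : 'I_n) (k : nat) (a : R).

Local Notation e_ i := (delta_mx ord0 i : 'rV[R]_n).

Lemma is_Ck_pred k f : is_Ck k.+1 f -> is_Ck k f.
Proof.
elim: k f => [|k ih] f; first by case.
move=> [cf df]; split => // i; have [fi fk] := df i.
by split => //; exact: ih.
Qed.

Lemma is_smooth_continuous f : is_smooth f -> continuous f.
Proof. by move=> /(_ 0). Qed.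

Lemma is_smooth_derivable f i x : is_smooth f -> derivable f x (e_ i).
Proof. by move=> /(_ 1)[_ /(_ i)[]]. Qed.

Lemma is_smooth_partial f i : is_smooth f -> is_smooth (partial i f).
Proof. by move=> sf k; have [_ /(_ i)[]] := sf k.+1. Qed.

Lemma partial_cst a i : partial i (fun=> a) = fun=> (0 : R).
Proof. by apply/funext => x; rewrite /partial derive_cst. Qed.

Lemma is_smooth_cst a : is_smooth (fun _ : 'rV[R]_n => a).
Proof.
move=> k; elim: k a => [|k ih] a; first exact: cst_continuous.
split; first exact: cst_continuous.
by move=> i; rewrite partial_cst; split => [x|]; [exact: derivable_cst|exact: ih].
Qed.

Lemma partialD f g i x : derivable f x (e_ i) -> derivable g x (e_ i) ->
  partial i (fun y => f y + g y) x = partial i f x + partial i g x.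
Proof. exact: deriveD. Qed.

Lemma partialM f g i x : derivable f x (e_ i) -> derivable g x (e_ i) ->
  partial i (fun y => f y * g y) x = f x * partial i g x + g x * partial i f x.
Proof. exact: deriveM. Qed.

Lemma partialZ f a i x : derivable f x (e_ i) ->
  partial i (fun y => a * f y) x = a * partial i f x.
Proof. exact: deriveZ. Qed.

Lemma is_CkD k f g : is_Ck k f -> is_Ck k g -> is_Ck k (fun x => f x + g x).
Proof.
elim: k f g => [|k ih] f g /=.
  by move=> cf cg x; apply: continuousD; [exact: cf|exact: cg].
move=> [cf df] [cg dg]; split.
  by move=> x; apply: continuousD; [exact: cf|exact: cg].
move=> i; have [[fi fk] [gi gk]] := (df i, dg i).
split; first by move=> x; exact: derivableD.
rewrite (_ : partial i _ = fun x => partial i f x + partial i g x); first exact: ih.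
by apply/funext => x; exact: partialD.
Qed.

Lemma is_CkM k f g : is_Ck k f -> is_Ck k g -> is_Ck k (fun x => f x * g x).
Proof.
elim: k f g => [|k ih] f g.
  by move=> /= cf cg x; apply: continuousM; [exact: cf|exact: cg].
move=> Cf Cg; have [[cf df] [cg dg]] := (Cf, Cg); split.
  by move=> x; apply: continuousM; [exact: cf|exact: cg].
move=> i; have [[fi fk] [gi gk]] := (df i, dg i).
split; first by move=> x; exact: derivableM.
rewrite (_ : partial i _ = fun x => f x * partial i g x + g x * partial i f x).
  by apply: is_CkD; apply: ih => //; exact: is_Ck_pred.
by apply/funext => x; exact: partialM.
Qed.

Lemma is_smoothD f g : is_smooth f -> is_smooth g -> is_smooth (fun x => f x + g x).
Proof. by move=> sf sg k; exact: is_CkD. Qed.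

Lemma is_smoothM f g : is_smooth f -> is_smooth g -> is_smooth (fun x => f x * g x).
Proof. by move=> sf sg k; exact: is_CkM. Qed.

Lemma is_smoothZ a f : is_smooth f -> is_smooth (fun x => a * f x).
Proof. by move=> sf; apply: is_smoothM => //; exact: is_smooth_cst. Qed.

Lemma derive_line f x v : 'D_v f x = derive1 (fun h : R => f (h *: v + x)) 0.
Proof.
rewrite /derive /derive1.
rewrite (_ : (fun h : R => h^-1 *: ((f \o shift x) (h *: v) - f x)) =
  (fun h : R => h^-1 *: (f ((h + 0) *: v + x) - f (0 *: v + x))))//.
by apply/funext => h /=; rewrite addr0 scale0r add0r.
Qed.

(** Only a directional derivative of [f] is given, so the chain rule is applied to the one-variable
    function h |-> f (h v + x) at 0. *)
Lemma is_derive_ijb f x v : derivable f x v ->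
  derivable (ijb f) x v /\ 'D_v (ijb f) x = - (f x * 'D_v f x * ijb f x ^+ 3).
Proof.
move=> df; have /derivable1P dF := df.
set F := fun h : R => f (h *: v + x) in dF.
have F0 : F 0 = f x by rewrite /F scale0r add0r.
have dF' : is_derive (0 : R) 1 F ('D_v f x).
  by apply: DeriveDef => //; rewrite derive_line derive1E.
have h0 : 0 < 1 + F 0 ^+ 2 by rewrite ltr_pwDl// sqr_ge0.
pose S (t : R) := 1 + F t ^+ 2.
have dS : is_derive (0 : R) 1 S (2 * F 0 * 'D_v f x).
  have := is_deriveD (is_derive_cst (1 : R) (0 : R) 1) (is_deriveX 2 dF').
  by move=> h; apply: (is_derive_eq h); rewrite /= expr1 add0r.
have dQ : is_derive (0 : R) 1 (Num.sqrt \o S) ((2 * Num.sqrt (S 0))^-1 * (2 * F 0 * 'D_v f x)).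
  have dsq : is_derive (S 0) 1 Num.sqrt (2 * Num.sqrt (S 0))^-1 by exact: is_derive1_sqrt.
  exact: (@is_derive1_comp _ Num.sqrt S 0 _ _ dsq dS).
have q0 : (Num.sqrt \o S) 0 != 0 by rewrite /= gt_eqF// sqrtr_gt0.
have dI := is_deriveV q0 dQ.
have E : (fun h : R => ijb f (h *: v + x)) = (fun t => ((Num.sqrt \o S) t)^-1) by [].
split.
  by apply/derivable1P; rewrite -/(ijb f) E; case: dI.
rewrite derive_line E derive1E; have [_ ->] := dI.
rewrite /= /ijb -F0 -/(S 0) /GRing.scale /=.
have := sqrtr_gt0 (S 0); rewrite h0; set q := Num.sqrt _ => q0'.
by field; rewrite gt_eqF.
Qed.

Lemma partial_ijb f i x : derivable f x (e_ i) ->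
  partial i (ijb f) x = - (f x * partial i f x * ijb f x ^+ 3).
Proof. by move=> /is_derive_ijb[]. Qed.

(** The derivative of s is - f (partial f) s^3, a polynomial in smooth functions and s itself; hence
    s of class C^k makes its partial derivatives C^k. *)
Lemma is_smooth_ijb f : is_smooth f -> is_smooth (ijb f).
Proof.
move=> sf k; have cs := continuous_ijb (is_smooth_continuous sf).
elim: k => [//|k ih]; split => // i; split.
  by move=> x; have [] := is_derive_ijb (is_smooth_derivable (i := i) (x := x) sf).
rewrite (_ : partial i _ = fun x => -1 * ((f x * partial i f x) *
    (ijb f x * (ijb f x * ijb f x)))).
  apply: is_CkM; first exact: is_smooth_cst.
  apply: is_CkM; last by do 2 apply: is_CkM => //.
  by apply: is_CkM; [exact: sf|exact: is_smooth_partial].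
apply/funext => x; rewrite partial_ijb; first by ring.
exact: is_smooth_derivable.
Qed.

End smooth_calculus.

(** * Stability properties of the space of test functions *)

Section Cc_smooth_theory.
Context {R : realType} {n : nat} (Omega : set 'rV[R]_n).
Implicit Types (f g : 'rV[R]_n -> R) (i : 'I_n) (a : R).

Local Notation Cc := (Cc_smooth Omega).

Lemma Cc_smooth_sub f g : Cc f -> is_smooth g -> (forall x, f x = 0 -> g x = 0) ->
  Cc g.
Proof.
move=> [_ cf fO] sg fg.
have gf : closure [set x | g x != 0] `<=` closure [set x | f x != 0].
  by apply: closureS => x /=; apply: contra_neq; exact: fg.
split => //; last exact: subset_trans fO.
exact: subclosed_compact (@closed_closure _ _) cf gf.
Qed.

Lemma Cc_smoothD f g : Cc f -> Cc g -> Cc (fun x => f x + g x).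
Proof.
move=> [sf cf fO] [sg cg gO].
have sub : closure [set x | f x + g x != 0] `<=`
    closure [set x | f x != 0] `|` closure [set x | g x != 0].
  rewrite -closureU; apply: closureS => x /=; have [->|] := eqVneq (f x) 0.
    by rewrite add0r; right.
  by left.
split; first exact: is_smoothD.
- apply: subclosed_compact sub; first exact: closed_closure.
  exact: compactU.
- by apply: subset_trans sub _; rewrite subUset.
Qed.

Lemma Cc_smoothM f g : Cc f -> is_smooth g -> Cc (fun x => f x * g x).
Proof.
move=> Cf sg; apply: (Cc_smooth_sub Cf); first by apply: is_smoothM => //; case: Cf.
by move=> x ->; rewrite mul0r.
Qed.

Lemma Cc_smoothZ a f : Cc f -> Cc (fun x => a * f x).
Proof.
move=> Cf; apply: (Cc_smooth_sub Cf); first by apply: is_smoothZ; case: Cf.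
by move=> x ->; rewrite mulr0.
Qed.

Lemma Cc_smooth_partial f i : Cc f -> Cc (partial i f).
Proof.
move=> [sf cf fO].
have sub : closure [set x | partial i f x != 0] `<=` closure [set x | f x != 0].
  rewrite [X in _ `<=` X](closure_id _).1; last exact: closed_closure.
  apply: closureS => x /=; apply: contra_neqP => fx.
  have : nbhs x (~` closure [set x | f x != 0]).
    by apply: open_nbhs_nbhs; split => //; exact: closed_openC (@closed_closure _ _).
  move=> nx; rewrite /partial (@near_eq_derive _ _ _ _ (cst 0)) ?derive_cst//.
  apply: filterS nx => y ncy; apply/eqP/negPn/negP => fy; apply: ncy.
  exact: subset_closure.
split; first exact: is_smooth_partial.
- exact: subclosed_compact (@closed_closure _ _) cf sub.
- exact: subset_trans fO.
Qed.

Lemma Cc_smooth_out f x : Cc f -> ~ Omega x -> f x = 0.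
Proof.
move=> [_ _ fO] nOx; apply/eqP/negPn/negP => fx; apply: nOx; apply: fO.
exact: subset_closure.
Qed.

End Cc_smooth_theory.

(** * Lebesgue measure on R^n *)

Section borel_rV.
Context {R : realType}.

Lemma measurable_rV_ball n (q : 'rV[R]_n) (e : R) : 0 < e -> measurable (ball q e).
Proof.
move=> e0.
have -> : ball q e = \bigcap_(j in [set: 'I_n])
    ((fun x : 'rV[R]_n => x ord0 j : measurableTypeR R) @^-1` ball (q ord0 j) e).
  apply/seteqP; split => [x [_ qx]|x].
    by move=> j _ /=; exact: qx.
  move=> qx; split => // i j; rewrite (ord1 i).
  exact: (qx j I).
apply: fin_bigcap_measurable => // j _; rewrite -[X in measurable X]setTI.
by apply: measurable_rV_coord => //; exact: measurable_ball.
Qed.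

(** An open set is the union of the countably many balls with rational centre and radius 1 / (k + 1)
    that it contains. A ball of the max norm is a finite intersection of coordinate preimages of
    intervals, hence measurable. *)
Lemma open_measurable_rV n (A : set 'rV[R]_n) : open A -> measurable A.
Proof.
move=> oA.
pose B (p : 'rV[rat]_n * nat) : set 'rV[R]_n := ball (map_mx ratr p.1 : 'rV[R]_n) p.2.+1%:R^-1.
have -> : A = \bigcup_(p in [set: 'rV[rat]_n * nat]) (if `[< B p `<=` A >] then B p else set0).
  apply/seteqP; split => [x Ax|x [p _]]; last first.
    by case: ifPn => [/asboolP BA /BA|].
  have /nbhs_ballP[e /= e0 xA] : nbhs x A by exact: open_nbhs_nbhs.
  (* Radius below e / 2: the ball around a rational point q that contains x then stays within
     distance e of x. *)
  have [k ke] : exists k : nat, k.+1%:R^-1 < e / 2.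
    have /cvgrPdist_lt/(_ _ (divr_gt0 e0 (ltr0Sn _ 1)))[k _ /(_ k (leqnn k))] := @cvg_harmonic R.
    rewrite /= sub0r normrN ger0_norm ?invr_ge0// => ke; exists k; exact: ke.
  have d0 : 0 < k.+1%:R^-1 :> R by rewrite invr_gt0.
  have qx j : exists q : rat, `|ratr q - x ord0 j| < k.+1%:R^-1 :> R.
    have /rat_in_itvoo[q] : x ord0 j - k.+1%:R^-1 < x ord0 j + k.+1%:R^-1.
      by rewrite (@lt_trans _ _ (x ord0 j)) ?ltrDl// gtrBl.
    by rewrite in_itv/= => /andP[? ?]; exists q; rewrite ltr_distl; apply/andP.
  pose q : 'rV[rat]_n := \row_j xget 0 [set q : rat | `|ratr q - x ord0 j| < k.+1%:R^-1 :> R].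
  have Bx : B (q, k) x.
    split => // i j; rewrite (ord1 i) !mxE /ball /=.
    by case: xgetP => [y _ //|]; have [r rx] := qx j => /(_ r).
  exists (q, k) => //; rewrite asboolT// => y By; apply: xA.
  rewrite [e]splitr; apply: (@ball_triangle _ _ (map_mx ratr q : 'rV[R]_n)).
    by apply: ball_sym; apply: le_ball Bx; exact: ltW.
  by apply: le_ball By; exact: ltW.
apply: countable_bigcupT_measurable => [|p]; first exact: countableP.
by case: ifPn => // _; apply: measurable_rV_ball; rewrite invr_gt0.
Qed.

Lemma continuous_measurable_rV n (D : set 'rV[R]_n) (f : 'rV[R]_n -> R) :
  continuous f -> measurable_fun D f.
Proof.
move=> cf; apply: measurable_funTS.
apply: (measurability _ (RGenOpens.measurableE R)).
move=> _ [_ [a [b ->] <-]]; rewrite setTI; apply: open_measurable_rV.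
move/continuousP : cf; apply; exact: interval_open.
Qed.

(** Stated by coordinates so that its preimage under [rV_cons] is the product of [-M, M] with the
    cube of one dimension less. *)
Definition cube n (M : R) : set 'rV[R]_n := [set x | forall j, `|x ord0 j| <= M].

Lemma measurable_cube n M : measurable (@cube n M).
Proof.
have -> : @cube n M = \bigcap_(j in [set: 'I_n])
    ((fun x : 'rV[R]_n => x ord0 j : measurableTypeR R) @^-1` `[-M, M]).
  apply/seteqP; split => [x xM|x].
    by move=> j _ /=; rewrite in_itv/= -ler_norml.
  by move=> xM j; have := xM j I; rewrite /= in_itv/= -ler_norml.
apply: fin_bigcap_measurable => // j _; rewrite -[X in measurable X]setTI.
by apply: measurable_rV_coord => //; exact: measurable_itv.
Qed.

Lemma compact_cube n M : compact (@cube n M).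
Proof.
have -> : @cube n M = [set v : 'rV[R]_n | forall j, [set` `[-M, M]] (v ord0 j)].
  by apply/seteqP; split => x xM j; have := xM j; rewrite /= in_itv/= -ler_norml.
by apply: (@rV_compact R n (fun=> [set` `[-M, M]])) => j; exact: segment_compact.
Qed.

Lemma cube_fin n M : (lebesgue_rV n (@cube n M) < +oo)%E.
Proof.
elim: n => [|n ih].
  by rewrite /= diracE; case: (_ \in _); rewrite ltry.
pose I : set (measurableTypeR R) := [set` `[-M, M]].
have -> : lebesgue_rV n.+1 (@cube n.+1 M) =
    ((@lebesgue_measure R \x lebesgue_rV n) (I `*` cube M))%E.
  rewrite /= /lebesgue_rV_step /pushforward; congr (product_measure1 _ _ _).
  apply/seteqP; split => -[t y] /=.
    move=> tyM; split.
      rewrite /I /= in_itv/= -ler_norml; have := tyM (@lshift 1 n ord0).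
      by rewrite /rV_cons (@row_mxEl _ 1 1 n) mxE eqxx.
    by move=> j; have := tyM (@rshift 1 n j); rewrite /rV_cons (@row_mxEr _ 1 1 n).
  move=> [+ yM]; rewrite /I /= in_itv/= -ler_norml => tM i.
  case: (@split_ordP 1 n i) => j -> {i}.
    by rewrite /rV_cons (@row_mxEl _ 1 1 n) mxE (ord1 j) eqxx.
  by rewrite /rV_cons (@row_mxEr _ 1 1 n).
have IE : lebesgue_measure I \is a fin_num.
  by rewrite lebesgue_measure_itv/=; case: ifP.
rewrite product_measure1E//; [|exact: measurable_itv|exact: measurable_cube].
by rewrite lte_mul_pinfty.
Qed.

Lemma bounded_sub_cube n (A : set 'rV[R]_n) : bounded_set A ->
  exists M, 0 <= M /\ A `<=` cube M.
Proof.
move=> [M [_ /(_ (`|M| + 1))]].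
have -> : M < `|M| + 1 by rewrite ltr_pwDr// ler_norm.
move=> /(_ isT) AM; exists (`|M| + 1); split; first by rewrite addr_ge0.
move=> x /AM /= xM j; apply: le_trans xM.
rewrite /Num.norm/= mx_normrE.
exact: (le_bigmax _ (fun ij : 'I_1 * 'I_n => `|x ij.1 ij.2|) (ord0, j)).
Qed.

Lemma bounded_fin n (A : set 'rV[R]_n) : measurable A -> bounded_set A ->
  (lebesgue_rV n A < +oo)%E.
Proof.
move=> mA /bounded_sub_cube[M [_ AM]]; apply: le_lt_trans (cube_fin n M).
by apply: le_measure => //; rewrite inE//; exact: measurable_cube.
Qed.

(** Supplies the integrability over the whole space that Fubini requires. *)
Lemma intg_vanish_cube n (g : 'rV[R]_n -> R) M : continuous g ->
  (forall x, ~ cube M x -> g x = 0) ->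
  (lebesgue_rV n).-integrable setT (EFin \o g).
Proof.
move=> cg g0.
have gi : (lebesgue_rV n).-integrable (cube M) (EFin \o g).
  apply: measurable_bounded_integrable; [exact: measurable_cube|exact: cube_fin|..].
    exact: continuous_measurable_rV.
  have : compact (g @` cube M).
    by apply: continuous_compact; [exact: continuous_subspaceT|exact: compact_cube].
  move=> /compact_bounded[K [rK gK]]; exists K; split => // L /gK {}gK x xM.
  by apply: gK; exists x.
have -> : EFin \o g = (EFin \o g) \_ (cube M).
  apply/funext => x; rewrite patchE; case: ifPn => // /negP xM /=.
  by rewrite g0// => xM'; apply: xM; exact: mem_set.
by move: gi; rewrite integrable_mkcond//; exact: measurable_cube.
Qed.

End borel_rV.

(** * Integrals of partial derivatives of compactly supported functions *)

Section integration_by_parts.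
Context {R : realType}.

Lemma rV_consl n (t : R) (y : 'rV[R]_n) j : rV_cons (t, y) ord0 (@lshift 1 n j) = t.
Proof. by rewrite /rV_cons (@row_mxEl _ 1 1 n) mxE (ord1 j) eqxx. Qed.

Lemma rV_consr n (t : R) (y : 'rV[R]_n) j : rV_cons (t, y) ord0 (@rshift 1 n j) = y ord0 j.
Proof. by rewrite /rV_cons (@row_mxEr _ 1 1 n). Qed.

(** With [rV_cons_tail], this identifies lines along the first basis vector with the first slot of
    [rV_cons], and lines along the others with lines in the remaining slot; partial derivatives then
    restrict to slices. *)
Lemma rV_cons_head n (t : R) (y : 'rV[R]_n) :
  rV_cons (t, y) = t *: delta_mx ord0 (@lshift 1 n ord0) + rV_cons (0, y).
Proof.
apply/rowP => i; rewrite [RHS]mxE [X in _ = X + _]mxE [X in _ = _ * X + _]mxE eqxx /=; case: (@split_ordP 1 n i) => j -> {i}.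
  by rewrite !rV_consl (ord1 j) eqxx mulr1 addr0.
by rewrite !rV_consr eq_rlshift mulr0 add0r.
Qed.

Lemma rV_cons_tail n (t h : R) (y : 'rV[R]_n) j :
  rV_cons (t, h *: delta_mx ord0 j + y) =
  h *: delta_mx ord0 (@rshift 1 n j) + rV_cons (t, y).
Proof.
apply/rowP => i; rewrite [RHS]mxE [X in _ = X + _]mxE [X in _ = _ * X + _]mxE eqxx /=; case: (@split_ordP 1 n i) => k -> {i}.
  by rewrite !rV_consl eq_lrshift mulr0 add0r.
by rewrite !rV_consr 3!mxE eqxx eq_rshift.
Qed.

Lemma continuous_rV_consr n (t : R) : continuous (fun y : 'rV[R]_n => rV_cons (t, y)).
Proof.
move=> y A /nbhs_ballP[e /= e0 eA]; apply/nbhs_ballP; exists e => // z [_ yz].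
apply: eA; split => // i k; rewrite (ord1 i).
case: (@split_ordP 1 n k) => j -> {k}.
  by rewrite !rV_consl; exact: ballxx.
by rewrite !rV_consr; exact: yz.
Qed.

Lemma continuous_rV_consl n (y : 'rV[R]_n) : continuous (fun t : R => rV_cons (t, y)).
Proof.
move=> t A /nbhs_ballP[e /= e0 eA]; apply/nbhs_ballP; exists e => // s ts.
apply: eA; split => // i k; rewrite (ord1 i).
case: (@split_ordP 1 n k) => j -> {k}.
  by rewrite !rV_consl.
by rewrite !rV_consr; exact: ballxx.
Qed.

Lemma derivable_line n (f : 'rV[R]_n -> R) (x v : 'rV[R]_n) (t : R) :
  derivable f (t *: v + x) v -> is_derive t 1 (fun h : R => f (h *: v + x))
    ('D_v f (t *: v + x)).
Proof.
have E : (fun h : R => h^-1 *: (((fun h : R => f (h *: v + x)) \o shift t) (h *: 1) -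
    f (t *: v + x))) =
    (fun h : R => h^-1 *: ((f \o shift (t *: v + x)) (h *: v) - f (t *: v + x))).
  apply/funext => h /=; congr (_ *: (f _ - _)).
  by rewrite scalerDl addrA scaler1.
move=> df; apply: DeriveDef; first by rewrite /derivable E.
by rewrite /derive E.
Qed.

Lemma partial_vanish n (f : 'rV[R]_n -> R) i M :
  (forall x, ~ cube M x -> f x = 0) -> forall x, ~ cube M x -> partial i f x = 0.
Proof.
move=> f0 x xM; have cM : closed (~` ~` cube M : set 'rV[R]_n).
  rewrite setCK; apply: compact_closed; last exact: compact_cube.
  exact: norm_hausdorff.
have nx : nbhs x (~` cube M) by apply: open_nbhs_nbhs; split => //; rewrite -closedC.
rewrite /partial (@near_eq_derive _ _ _ _ (cst 0)) ?derive_cst//.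
by apply: filterS nx => y; exact: f0.
Qed.

Lemma integral_lebesgue_rVS n (g : 'rV[R]_n.+1 -> R) :
  (lebesgue_rV n.+1).-integrable setT (EFin \o g) ->
  ((@lebesgue_measure R \x lebesgue_rV n)%E).-integrable setT
    (fun p => (g (rV_cons p))%:E) /\
  (\int[lebesgue_rV n.+1]_x (g x)%:E =
   \int[(@lebesgue_measure R \x lebesgue_rV n)%E]_p (g (rV_cons p))%:E)%E.
Proof.
pose product : {measure set (measurableTypeR R * 'rV[R]_n)%type -> \bar R} :=
  (@lebesgue_measure R \x lebesgue_rV n)%E.
pose P : {measure set 'rV[R]_n.+1 -> \bar R} :=
  measure_function_pushforward__canonical__measure_function_Measure
    product (@measurable_rV_cons R n).
have PE h : (\int[lebesgue_rV n.+1]_x h x = \int[P]_x h x)%E.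
  exact: eq_measure_integral.
move=> /integrableP[mg gi].
have gi' : product.-integrable setT (fun p => (g (rV_cons p))%:E).
  apply/integrableP; split.
    by apply: (measurableT_comp mg); exact: measurable_rV_cons.
  move: gi; rewrite PE ge0_integral_pushforward//; first exact: measurable_rV_cons.
  exact: measurableT_comp.
split => //; rewrite PE integral_pushforward//.
exact: measurable_rV_cons.
Qed.

(** The fundamental theorem of calculus on [-K, K]. The choice K = |M| + 1 exceeds M and is positive
    whatever the sign of M, so [F] vanishes at both endpoints. *)
Lemma integral_derive1_eq0 (F G : R -> R) (M : R) : continuous G ->
  (forall t, is_derive t (1 : R) F (G t)) ->
  (forall t, M < `|t| -> F t = 0) -> (forall t, M < `|t| -> G t = 0) ->
  (\int[lebesgue_measure]_t (G t)%:E = 0)%E.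
Proof.
move=> cG dF F0 G0; pose K : R := `|M| + 1.
have MK : M < K by rewrite ltr_pwDr// ler_norm.
have K0 : 0 < K by rewrite ltr_pwDr.
transitivity (\int[lebesgue_measure]_(t in [set` `[(- K)%R, K]]) (G t)%:E)%E.
  rewrite [RHS]integral_mkcond; apply: eq_integral => t _; rewrite patchE.
  case: ifPn => // /negP tK; rewrite G0// (lt_le_trans MK)// leNgt; apply/negP => tK'.
  by apply: tK; rewrite inE/= in_itv/= -ler_norml ltW.
rewrite (@continuous_FTC2 _ _ F).
- by rewrite !F0 ?subee// ?normrN ger0_norm// ltW.
- by lra.
- exact: continuous_subspaceT.
- have dc t : {for t, continuous F}.
    by apply/differentiable_continuous/derivable1_diffP; case: (dF t).
  split; [by move=> t _; case: (dF t)|apply: cvg_at_right_filter|apply: cvg_at_left_filter]; exact: dc.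
- by move=> t _; rewrite derive1E; case: (dF t).
Qed.

(** Fubini with the order of integration adapted to [i]. For the first coordinate the inner integral
    is over t and vanishes by [integral_derive1_eq0]; for another one it is over the remaining
    variables and vanishes by induction, applied to the slice at t. *)
Theorem integral_partial_eq0 n (f : 'rV[R]_n -> R) i M :
  (forall x, ~ cube M x -> f x = 0) ->
  (forall x, derivable f x (delta_mx ord0 i)) -> continuous (partial i f) ->
  (\int[lebesgue_rV n]_x (partial i f x)%:E = 0)%E.
Proof.
elim: n f i => [f [] //|n ih f i f0 df cf].
have gi := intg_vanish_cube cf (partial_vanish i f0).
have [gi' ->] := integral_lebesgue_rVS gi.
have out (t : R) (y : 'rV[R]_n) : M < `|t| -> ~ cube M (rV_cons (t, y)).
  by move=> Mt /(_ (@lshift 1 n ord0)); rewrite rV_consl leNgt Mt.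
move: gi'; case: (@split_ordP 1 n i) df cf => j -> df cf gi'.
- rewrite (ord1 j) in df cf gi' *.
  rewrite -(integral21_prod_meas1 gi') integral0_eq// => y _.
  rewrite /fubini_G.
  apply: (@integral_derive1_eq0 (fun t => f (rV_cons (t, y))) _ M).
  + by move=> t; apply: continuous_comp; [exact: continuous_rV_consl|exact: cf].
  + move=> t; rewrite rV_cons_head.
    under [X in is_derive _ _ X _]funext => s do rewrite rV_cons_head.
    exact: derivable_line.
  + by move=> t Mt; apply: f0; exact: out.
  + by move=> t Mt; apply: (partial_vanish _ f0); exact: out.
- rewrite -(integral12_prod_meas1 gi') integral0_eq// => t _.
  rewrite /fubini_F.
  have E : (fun y => partial (@rshift 1 n j) f (rV_cons (t, y))) =
      partial j (fun y => f (rV_cons (t, y))).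
    apply/funext => y; rewrite /partial !derive_line; congr (derive1 _ _).
    by apply/funext => h; rewrite rV_cons_tail.
  under eq_integral do rewrite [partial _ _ _](congr1 (fun F => F _) E).
  apply: ih.
  + move=> y yM; apply: f0; apply: contra_not yM => yM k.
    by have := yM (@rshift 1 n k); rewrite rV_consr.
  + move=> y; have [+ _] := derivable1P f (rV_cons (t, y)) (delta_mx ord0 (@rshift 1 n j)).
    move=> /(_ (df _)) fy; apply/derivable1P.
    have -> : (fun h : R => f (rV_cons (t, h *: delta_mx ord0 j + y))) =
        (fun h : R => f (h *: delta_mx ord0 (@rshift 1 n j) + rV_cons (t, y))).
      by apply/funext => h; rewrite rV_cons_tail.
    exact: fy.
  + rewrite -E => y; apply: continuous_comp; [exact: continuous_rV_consr|exact: cf].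
Qed.

End integration_by_parts.

(** * The space [L2] in terms of real-valued integrals *)

Section L2_bridge.
Context {R : realType} {n : nat} (Omega : set 'rV[R]_n).
Hypothesis mOmega : measurable Omega.

Local Notation mu := (lebesgue_rV n).

Lemma L2_sqi (f : 'rV[R]_n -> R) : L2 Omega f <-> sqi mu Omega f.
Proof.
have fE : (EFin \o (fun x => f x ^+ 2)) \_ Omega =
    EFin \o (fun x => (f \_ Omega) x ^+ 2).
  apply/funext => x; rewrite /= !patchE; case: ifPn => // _.
  by rewrite expr0n.
have mfE : measurable_fun setT (f \_ Omega) <-> measurable_fun Omega f.
  by split => /(measurable_restrictT _ mOmega).
split => [fL|[mf fi]].
  have mf : measurable_fun setT (f \_ Omega).
    by move: fL; rewrite /L2/= inE => /andP[]; rewrite inE.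
  split; first exact/mfE.
  have := Lfun2_integrable_sqr fL; rewrite -fE.
  by move/(integrable_mkcond _ mOmega).
rewrite /L2/= inE; apply/andP; split; rewrite inE/=; first exact/mfE.
have : mu.-integrable setT (EFin \o (fun x => (f \_ Omega) x ^+ 2)).
  by rewrite -fE; apply/(integrable_mkcond _ mOmega).
move=> /integrableP[_ foo]; rewrite /finite_norm unlock.
apply: poweR_lty; apply: le_lt_trans foo.
apply: ge0_le_integral => //=.
- apply: measurableT_comp => //.
  apply/(@measurableT_comp _ _ _ _ _ _ (fun x : R => x `^ 2)%R) => //.
  by apply: measurableT_comp => //; exact/mfE.
- do 2 apply: measurableT_comp => //; apply: measurable_funX; exact/mfE.
- by move=> x _; rewrite lee_fin normrX powR_mulrn.
Qed.

End L2_bridge.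

(** * Integrals of smooth functions over a bounded open set, and the Rayleigh quotient *)

Section smooth_integrals.
Context {R : realType} {n : nat} (Omega : set 'rV[R]_n).
Hypotheses (oOmega : open Omega) (bOmega : bounded_set Omega).
Implicit Types (f g phi psi : 'rV[R]_n -> R) (i : 'I_n).

Local Notation mu := (lebesgue_rV n).
Local Notation Cc := (Cc_smooth Omega).
Local Notation intg f := (mu.-integrable Omega (fun x => (f x)%:E)).
Local Notation int f := (\int[mu]_(x in Omega) f x).

Lemma domain_measurable : measurable Omega.
Proof. exact: open_measurable_rV. Qed.
Let mOmega := domain_measurable.

Lemma domain_fin : (mu Omega < +oo)%E.
Proof. exact: bounded_fin. Qed.

Lemma smooth_bounded g : is_smooth g ->
  exists M, 0 <= M /\ forall x, Omega x -> `|g x| <= M.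
Proof.
move=> sg; have [K [_ OK]] := bounded_sub_cube bOmega.
have : compact (g @` cube K).
  apply: continuous_compact; last exact: compact_cube.
  by apply: continuous_subspaceT; exact: is_smooth_continuous.
move=> /compact_bounded[M [_ /(_ (`|M| + 1))]].
have -> : M < `|M| + 1 by rewrite ltr_pwDr// ler_norm.
move=> /(_ isT) gM; exists (`|M| + 1); split; first by rewrite addr_ge0.
by move=> x /OK Kx; apply: gM; exists x.
Qed.

Lemma smooth_measurable g : is_smooth g -> measurable_fun Omega g.
Proof. by move=> sg; apply: continuous_measurable_rV; exact: is_smooth_continuous. Qed.

Lemma smooth_intg g : is_smooth g -> intg g.
Proof.
move=> sg; have [M [_ gM]] := smooth_bounded sg.
by apply: (intg_bounded mOmega domain_fin _ gM); exact: smooth_measurable.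
Qed.

Lemma smooth_sqi g : is_smooth g -> sqi mu Omega g.
Proof.
move=> sg; have [M [_ gM]] := smooth_bounded sg.
by apply: (sqi_bounded mOmega domain_fin _ gM); exact: smooth_measurable.
Qed.

Lemma Cc_smooth_smooth phi : Cc phi -> is_smooth phi.
Proof. by case. Qed.

Lemma Cc_smooth_int_partial phi i : Cc phi -> int (partial i phi) = 0.
Proof.
move=> Cphi; have [K [_ OK]] := bounded_sub_cube bOmega.
rewrite Rintegral_mkcond /Rintegral.
rewrite (_ : (fun x => _) = fun x => (partial i phi x)%:E).
  rewrite (@integral_partial_eq0 _ _ _ _ K)//.
  - by move=> x xK; apply: (Cc_smooth_out Cphi) => /OK.
  - by move=> x; apply: is_smooth_derivable; case: Cphi.
  - by apply: is_smooth_continuous; apply: is_smooth_partial; case: Cphi.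
apply/funext => x; rewrite patchE; case: ifPn => // /negP xO.
rewrite (Cc_smooth_out (Cc_smooth_partial i Cphi))// => Ox.
by apply: xO; exact: mem_set.
Qed.

(** The product phi psi is a test function even if only [phi] has compact support, so the integral
    of its partial derivative is 0. *)
Lemma Cc_smooth_parts phi psi i : Cc phi -> is_smooth psi ->
  int (fun x => phi x * partial i psi x) = - int (fun x => partial i phi x * psi x).
Proof.
move=> Cphi spsi; have sphi := Cc_smooth_smooth Cphi.
have sphi' := is_smooth_partial i sphi.
have spsi' := is_smooth_partial i spsi.
have := Cc_smooth_int_partial i (Cc_smoothM Cphi spsi).
rewrite (_ : partial i _ = fun x => phi x * partial i psi x + partial i phi x * psi x).
  rewrite RintegralD//=; last 2 first.
  - by apply: smooth_intg; exact: is_smoothM.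
  - by apply: smooth_intg; exact: is_smoothM.
  by move/eqP; rewrite addr_eq0 => /eqP.
apply/funext => x; rewrite partialM 1?[partial i phi x * _]mulrC//;
  exact: is_smooth_derivable.
Qed.

Lemma Cc_smooth_H1 phi : Cc phi -> exists v : H1 Omega,
  [/\ H10 v, H1_fun v = phi & weak_partial v = fun i => partial i phi].
Proof.
move=> Cphi; have sphi := Cc_smooth_smooth Cphi.
have w : forall i, is_weak_partial Omega i phi (partial i phi).
  move=> i psi Cpsi; exact: Cc_smooth_parts (Cc_smooth_smooth Cpsi).
have L : L2 Omega phi by apply/(L2_sqi mOmega)/smooth_sqi.
have L' i : L2 Omega (partial i phi).
  by apply/(L2_sqi mOmega)/smooth_sqi/is_smooth_partial.
exists (MkH1 L L' w); split => // e e0; exists phi => //=.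
rewrite /H1_norm.
have Z : forall g, int (fun x => (g x - g x) ^+ 2) = 0.
  move=> g; under eq_Rintegral do rewrite subrr expr0n/=.
  by rewrite Rintegral_cst// mul0r.
by rewrite Z big1 ?addr0 ?sqrtr0// => i _; exact: Z.
Qed.

(** A test function, with its classical derivatives, is a competitor in the infimum defining
    [lambda1], provided that its L^2 norm is nonzero; otherwise the left side is 0. *)
Lemma rayleigh_le (l : R) phi : (l%:E <= lambda1 Omega)%E -> Cc phi ->
  l * int (fun x => phi x ^+ 2) <= \sum_(i < n) int (fun x => partial i phi x ^+ 2).
Proof.
move=> ll Cphi; have sphi := Cc_smooth_smooth Cphi.
have [v [v0 vE dvE]] := Cc_smooth_H1 Cphi.
have E0 : 0 <= \sum_(i < n) int (fun x => partial i phi x ^+ 2).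
  by apply: sumr_ge0 => i _; exact: int_sq_ge0.
have [->|N0] := eqVneq (int (fun x => phi x ^+ 2)) 0; first by rewrite mulr0.
have Npos : 0 < int (fun x => phi x ^+ 2) by rewrite lt_neqAle eq_sym N0 int_sq_ge0.
rewrite -ler_pdivlMr//; rewrite -lee_fin; apply: le_trans ll _.
apply: ereal_inf_lbound; exists v; last first.
  rewrite vE dvE Rintegral_sum// => i.
  by apply: (smooth_sqi _).2; exact: is_smooth_partial.
split => //; rewrite vE => vae; move/eqP: N0; apply.
rewrite /Rintegral (ae_eq_integral (cst 0%E)) ?integral_cst ?mul0e//.
- apply/measurable_EFinP; apply: measurable_funX; exact: smooth_measurable.
- by apply: filterS vae => x /[apply] /= ->; rewrite expr0n.
Qed.

End smooth_integrals.

Lemma int_sqr_lin d (T : measurableType d) (R : realType)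
    (mu : {measure set T -> \bar R}) (D : set T) (mD : measurable D)
    (a b : T -> R) (s t : R) : sqi mu D a -> sqi mu D b ->
  \int[mu]_(x in D) (s * a x + t * b x) ^+ 2 =
  s ^+ 2 * \int[mu]_(x in D) (a x ^+ 2) + 2 * s * t * \int[mu]_(x in D) (a x * b x)
  + t ^+ 2 * \int[mu]_(x in D) (b x ^+ 2).
Proof.
move=> sa sb; have ab := sqi_mul mD sa sb; case: (sa) (sb) => [_ a2] [_ b2].
rewrite -!RintegralZl//= -RintegralD//=; [|exact: intgZ..].
rewrite -RintegralD//=; [|by apply: intgD => //; exact: intgZ|exact: intgZ].
by apply: eq_Rintegral => x _; ring.
Qed.

Section Rintegral_linear.
Context d (T : measurableType d) (R : realType).
Variables (mu : {measure set T -> \bar R}) (D : set T) (mD : measurable D).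
Implicit Types (f g h k : T -> R) (a b c e : R).
Local Notation intg f := (mu.-integrable D (fun x => (f x)%:E)).

Lemma intg_lin a b f g : intg f -> intg g -> intg (fun x => a * f x + b * g x).
Proof. by move=> fi gi; apply: intgD => //; exact: intgZ. Qed.

Lemma Rintegral_lin a b f g : intg f -> intg g ->
  \int[mu]_(x in D) (a * f x + b * g x) =
  a * \int[mu]_(x in D) f x + b * \int[mu]_(x in D) g x.
Proof.
by move=> fi gi; rewrite RintegralD//=; [rewrite !RintegralZl|exact: intgZ..].
Qed.

Lemma Rintegral_lin4 a b c e f g h k : intg f -> intg g -> intg h -> intg k ->
  \int[mu]_(x in D) ((a * f x + b * g x) + (c * h x + e * k x)) =
  (a * \int[mu]_(x in D) f x + b * \int[mu]_(x in D) g x) +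
  (c * \int[mu]_(x in D) h x + e * \int[mu]_(x in D) k x).
Proof.
move=> fi gi hi ki; rewrite RintegralD//=; [|exact: intg_lin..].
by rewrite !Rintegral_lin.
Qed.

Lemma Rintegral_split3 f g h k : intg g -> intg h -> intg k ->
  (forall x, f x = g x - h x + k x) ->
  \int[mu]_(x in D) f x =
  \int[mu]_(x in D) g x - \int[mu]_(x in D) h x + \int[mu]_(x in D) k x.
Proof.
move=> gi hi ki fE; rewrite -RintegralB//= -RintegralD//=; last exact: intgB.
by apply: eq_Rintegral => x _; exact: fE.
Qed.

End Rintegral_linear.

(** * The energy functional *)

Section energy_functional.
Context {R : realType} {n : nat} (Omega : set 'rV[R]_n).
Hypotheses (oOmega : open Omega) (bOmega : bounded_set Omega).
Variables (f : 'rV[R]_n -> R) (lambda : R).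
Hypothesis sf : sqi (lebesgue_rV n) Omega f.
Implicit Types (phi psi w a b : 'rV[R]_n -> R) (i : 'I_n).

Local Notation mu := (lebesgue_rV n).
Local Notation Cc := (Cc_smooth Omega).
Local Notation intg f := (mu.-integrable Omega (fun x => (f x)%:E)).
Local Notation int f := (\int[mu]_(x in Omega) f x).
Local Notation nrm2 := (nrm2 mu Omega).
Local Notation sqi := (sqi mu Omega).
Let mOmega := domain_measurable oOmega.

Definition dirichlet a b := \sum_(i < n) int (fun x => partial i a x * partial i b x).
Definition bil a b := dirichlet a b - lambda * int (fun x => a x * b x).
Definition energy a := \sum_(i < n) int (fun x => partial i a x ^+ 2).
Definition quad a := energy a - lambda * int (fun x => a x ^+ 2).
Definition J phi :=
  2^-1 * quad phi + 4^-1 * int (fun x => phi x ^+ 4) - int (fun x => f x * phi x).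
(** The derivative of [J] at [phi] in the direction [w]; setting it to zero for all test functions
    [w] is the weak equation for [phi]. *)
Definition dJ phi w :=
  bil phi w + int (fun x => phi x ^+ 3 * w x) - int (fun x => f x * w x).

Lemma is_smoothX (a : 'rV[R]_n -> R) k : is_smooth a -> is_smooth (fun x => a x ^+ k).
Proof.
move=> sa; elim: k => [|k ih].
  by under eq_fun do rewrite expr0; exact: is_smooth_cst.
by under eq_fun do rewrite exprS; exact: is_smoothM.
Qed.

Lemma is_smooth_lin a b s t : is_smooth a -> is_smooth b ->
  is_smooth (fun x => s * a x + t * b x).
Proof. by move=> sa sb; apply: is_smoothD; exact: is_smoothZ. Qed.

Lemma Cc_smooth_lin a b s t : Cc a -> Cc b -> Cc (fun x => s * a x + t * b x).
Proof. by move=> Ca Cb; apply: Cc_smoothD; exact: Cc_smoothZ. Qed.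

Lemma partial_lin a b s t i : is_smooth a -> is_smooth b ->
  partial i (fun x => s * a x + t * b x) =
  fun x => s * partial i a x + t * partial i b x.
Proof.
move=> sa sb; apply/funext => x; rewrite partialD ?partialZ//;
  by apply: is_smooth_derivable => //; exact: is_smoothZ.
Qed.

Let ssqi a : is_smooth a -> sqi a. Proof. exact: smooth_sqi. Qed.
Let sintg a : is_smooth a -> intg a. Proof. exact: smooth_intg. Qed.
Let psqi i a : is_smooth a -> sqi (partial i a).
Proof. by move=> sa; apply: ssqi; exact: is_smooth_partial. Qed.

Lemma energy_ge0 a : 0 <= energy a.
Proof. by apply: sumr_ge0 => i _; exact: int_sq_ge0. Qed.

Lemma energy_lin a b s t : is_smooth a -> is_smooth b ->
  energy (fun x => s * a x + t * b x) =
  s ^+ 2 * energy a + 2 * s * t * dirichlet a b + t ^+ 2 * energy b.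
Proof.
move=> sa sb; transitivity (\sum_(i < n) (s ^+ 2 * int (fun x => partial i a x ^+ 2) +
      2 * s * t * int (fun x => partial i a x * partial i b x) +
      t ^+ 2 * int (fun x => partial i b x ^+ 2))).
  apply: eq_bigr => i _; rewrite (partial_lin s t i sa sb).
  by rewrite (int_sqr_lin mOmega _ _ (psqi i sa) (psqi i sb)).
by rewrite 2!big_split/= /energy /dirichlet !mulr_sumr.
Qed.

Lemma quad_lin a b s t : is_smooth a -> is_smooth b ->
  quad (fun x => s * a x + t * b x) =
  s ^+ 2 * quad a + 2 * s * t * bil a b + t ^+ 2 * quad b.
Proof.
move=> sa sb; rewrite /quad /bil energy_lin//.
rewrite (int_sqr_lin mOmega _ _ (ssqi sa) (ssqi sb)).
move: (energy a) (energy b) (dirichlet a b) => ea eb eab.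
move: (Rintegral _ _ _) => ia.
move: (Rintegral _ _ _) => iab.
move: (Rintegral _ _ _) => ib.
by ring.
Qed.

Lemma int_source_lin a b s t : is_smooth a -> is_smooth b ->
  int (fun x => f x * (s * a x + t * b x)) =
  s * int (fun x => f x * a x) + t * int (fun x => f x * b x).
Proof.
move=> sa sb; have fa := sqi_mul mOmega sf (ssqi sa).
have fb := sqi_mul mOmega sf (ssqi sb).
rewrite -!RintegralZl//= -RintegralD//=; [|exact: intgZ..].
by apply: eq_Rintegral => x _; ring.
Qed.

(** An upper bound of second order in t suffices, since it is compared with the lower bound m at
    small t. The coefficients 2 and 1 are a quarter of the 8 and 4 in the pointwise quartic
    estimate. *)
Lemma J_expand phi w t : is_smooth phi -> is_smooth w -> `|t| <= 1 ->
  J (fun x => 1 * phi x + t * w x) <= J phi + t * dJ phi w +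
    t ^+ 2 * (2^-1 * quad w + 2 * int (fun x => phi x ^+ 2 * w x ^+ 2)
              + int (fun x => w x ^+ 4)).
Proof.
move=> sphi sw t1; have t21 : t ^+ 2 <= 1.
  by rewrite -real_normK ?num_real// exprn_ile1.
have i31 : intg (fun x => phi x ^+ 3 * w x).
  by apply: sintg; apply: is_smoothM => //; exact: is_smoothX.
have i22 : intg (fun x => phi x ^+ 2 * w x ^+ 2).
  by apply: sintg; apply: is_smoothM; exact: is_smoothX.
have i4 a : is_smooth a -> intg (fun x => a x ^+ 4).
  by move=> sa; apply: sintg; exact: is_smoothX.
have quartic : int (fun x => (1 * phi x + t * w x) ^+ 4) <=
    (1 * int (fun x => phi x ^+ 4) + 4 * t * int (fun x => phi x ^+ 3 * w x)) +
    (8 * t ^+ 2 * int (fun x => phi x ^+ 2 * w x ^+ 2) +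
     4 * t ^+ 2 * int (fun x => w x ^+ 4)).
  rewrite -(Rintegral_lin4 mOmega _ _ _ _ (i4 _ sphi) i31 i22 (i4 _ sw)).
  apply: le_Rintegral => //.
  - by apply: i4; exact: is_smooth_lin.
  - apply: intgD => //; apply: intg_lin => //; exact: i4.
  move=> x _; move: (phi x) (w x) => A B.
  (* Completing the square in A leaves a multiple of 4 - 3 t^2, which is positive because |t| <=
     1. *)
  rewrite -subr_ge0 (_ : _ - _ = 2 * t ^+ 2 * B ^+ 2 * (A - t * B) ^+ 2 +
    B ^+ 4 * t ^+ 2 * (4 - 3 * t ^+ 2)); last by ring.
  have t20 := sqr_ge0 t; have B20 := sqr_ge0 B; have B40 := sqr_ge0 (B ^+ 2).
  apply: addr_ge0.
    apply: mulr_ge0; last exact: sqr_ge0.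
    by apply: mulr_ge0 => //; apply: mulr_ge0.
  apply: mulr_ge0; last by lra.
  by apply: mulr_ge0 => //; rewrite (exprM B 2 2).
rewrite /J /dJ quad_lin// int_source_lin//.
by move: quartic; rewrite expr1n !mul1r; lra.
Qed.

(** The parallelogram identity for [quad] produces the term with 1 / 8 exactly; the quartic term is
    convex and the source term linear. *)
Lemma J_midpoint phi psi : is_smooth phi -> is_smooth psi ->
  J (fun x => 2^-1 * phi x + 2^-1 * psi x) <=
  2^-1 * (J phi + J psi) - 8^-1 * quad (fun x => 1 * phi x + -1 * psi x).
Proof.
move=> sphi spsi.
have i4 a : is_smooth a -> intg (fun x => a x ^+ 4).
  by move=> sa; apply: sintg; exact: is_smoothX.
have quartic : int (fun x => (2^-1 * phi x + 2^-1 * psi x) ^+ 4) <=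
    2^-1 * int (fun x => phi x ^+ 4) + 2^-1 * int (fun x => psi x ^+ 4).
  rewrite -(Rintegral_lin mOmega _ _ (i4 _ sphi) (i4 _ spsi)).
  apply: le_Rintegral => //.
  - by apply: i4; exact: is_smooth_lin.
  - by apply: intg_lin => //; exact: i4.
  move=> x _; move: (phi x) (psi x) => A B.
  rewrite -subr_ge0 (_ : _ - _ = 3 / 8 * (A ^+ 2 - B ^+ 2) ^+ 2 +
    16^-1 * (A - B) ^+ 4); last by field.
  rewrite addr_ge0// mulr_ge0 ?sqr_ge0//.
  by rewrite (exprM _ 2 2) sqr_ge0.
rewrite /J !quad_lin// int_source_lin//; move: quartic.
by lra.
Qed.

(** Take a real l with lambda < l <= lambda1 and put d = l - lambda. Splitting the energy E as th E
    + (1 - th) E and bounding the second part below by (1 - th) l N, with N the squared L^2 norm,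
    gives quad >= th E + (d - th l) N. *)
Lemma quad_coercive : (lambda%:E < lambda1 Omega)%E -> exists c, 0 < c /\
  forall phi, Cc phi -> c * (int (fun x => phi x ^+ 2) + energy phi) <= quad phi.
Proof.
move=> ll; have [l [lambdal l1]] : exists l : R, lambda < l /\ (l%:E <= lambda1 Omega)%E.
  move: ll; case: (lambda1 Omega) => [r| |//]; last by exists (lambda + 1); rewrite ltrDl leey.
  by rewrite lte_fin => lr; exists r.
pose d := l - lambda; have d0 : 0 < d by rewrite subr_gt0.
(* The summand |l| ensures th l <= d / 2, the summand d ensures th <= 1, and 1 keeps the denominator
   positive. *)
pose th := d / (2 * (1 + `|l| + d)).
have den : 0 < 1 + `|l| + d by rewrite addr_gt0// ltr_pwDl.
have th0 : 0 < th by rewrite divr_gt0// mulr_gt0.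
have thE : th * (2 * (1 + `|l| + d)) = d by rewrite divfK// gt_eqF// mulr_gt0.
have th1 : th <= 1.
  rewrite ler_pdivrMr ?mulr_gt0// mul1r; have := normr_ge0 l; lra.
have thl : th * l <= d / 2.
  have := ler_norm l; have := normr_ge0 l; nra.
pose c := Num.min th (d / 2); exists c; split.
  by rewrite lt_min th0 divr_gt0.
move=> phi Cphi; have := rayleigh_le oOmega bOmega l1 Cphi.
rewrite /quad; set N := Rintegral _ _ _; rewrite -/(energy phi); set E := energy phi => lNE.
have N0 : 0 <= N by exact: int_sq_ge0.
have E0 : 0 <= E by exact: energy_ge0.
have c1 : c <= th by rewrite ge_min lexx.
have c2 : c <= d / 2 by rewrite ge_min lexx orbT.
have h1 : (1 - th) * (l * N) <= (1 - th) * E by rewrite ler_wpM2l// subr_ge0.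
have h2 : c * E <= th * E by rewrite ler_wpM2r.
have h3 : c * N <= d / 2 * N by rewrite ler_wpM2r.
have h4 : th * l * N <= d / 2 * N by rewrite ler_wpM2r.
have h5 : d * N = l * N - lambda * N by rewrite mulrBl.
lra.
Qed.

(** Young's inequality absorbs the source term into half of the coercive term. The quartic term is
    kept: it yields the uniform L^4 bound along a minimizing sequence. *)
Lemma J_lower c phi : 0 < c -> Cc phi ->
  c * (int (fun x => phi x ^+ 2) + energy phi) <= quad phi ->
  4^-1 * int (fun x => phi x ^+ 4) - nrm2 f ^+ 2 / (2 * c) <= J phi.
Proof.
move=> c0 Cphi cq; have sphi := Cc_smooth_smooth Cphi.
have cs := cauchy_schwarz mOmega sf (ssqi sphi).
have E0 : 0 <= c * energy phi.
  by apply: mulr_ge0; [exact: ltW|exact: energy_ge0].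
rewrite /J; move: cq cs; rewrite -sqr_nrm2 mulrDr.
set q := quad phi; set F := int (fun x => f x * phi x).
set A := nrm2 f; set B := nrm2 phi => cq cs.
have : 0 <= (A / c - B) ^+ 2 * c by rewrite mulr_ge0 ?sqr_ge0// ltW.
have -> : (A / c - B) ^+ 2 * c = 2 * (A ^+ 2 / (2 * c)) - 2 * (A * B) + c * B ^+ 2.
  by field; rewrite gt_eqF.
by lra.
Qed.

Lemma Cc_smooth0 : Cc (fun=> 0).
Proof.
have E : closure [set x : 'rV[R]_n | (0 : R) != 0] = set0.
  rewrite (_ : [set x | _] = set0) ?closure0//.
  by apply/seteqP; split => x //=; rewrite eqxx.
split; [exact: is_smooth_cst|rewrite E; exact: compact0|by rewrite E].
Qed.

(** The rate 4^-k is chosen because [J] controls squared norms: it becomes the rate 2^-k for norms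
    that [riesz_fischer] expects. *)
Lemma minimizing_sequence (b0 : R) : (forall phi, Cc phi -> b0 <= J phi) ->
  exists m (phi : nat -> 'rV[R]_n -> R), [/\ forall k, Cc (phi k),
    forall psi, Cc psi -> m <= J psi & forall k, J (phi k) <= m + 4^-1 ^+ k].
Proof.
move=> b0J; pose S := [set J phi | phi in Cc].
have infS : has_inf S.
  split; first by exists (J (fun=> 0)), (fun=> 0) => //; exact: Cc_smooth0.
  by exists b0 => _ [phi Cphi <-]; exact: b0J.
have ex k : exists phi, Cc phi /\ J phi <= inf S + 4^-1 ^+ k.
  have k0 : 0 < 4^-1 ^+ k :> R by rewrite exprn_gt0// invr_gt0.
  have [_ [phi Cphi <-] Jphi] := inf_adherent k0 infS.
  by exists phi; split => //; exact: ltW.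
have [phi phiP] := choice ex; exists (inf S), phi; split.
- by move=> k; case: (phiP k).
- by move=> psi Cpsi; apply: (ge_inf infS.2); exists psi.
- by move=> k; case: (phiP k).
Qed.

End energy_functional.

(** * The minimizing sequence and its limit *)

Section minimizer.
Context {R : realType} {n : nat} (Omega : set 'rV[R]_n).
Hypotheses (oOmega : open Omega) (bOmega : bounded_set Omega).
Variables (f : 'rV[R]_n -> R) (lambda : R).
Hypothesis sf : sqi (lebesgue_rV n) Omega f.
Hypothesis lambda_lt : (lambda%:E < lambda1 Omega)%E.
Implicit Types (phi psi w a b u v : 'rV[R]_n -> R) (i : 'I_n).

Local Notation mu := (lebesgue_rV n).
Local Notation Cc := (Cc_smooth Omega).
Local Notation intg f := (mu.-integrable Omega (fun x => (f x)%:E)).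
Local Notation int f := (\int[mu]_(x in Omega) f x).
Local Notation nrm2 := (nrm2 mu Omega).
Local Notation sqi := (sqi mu Omega).
Local Notation quad := (quad Omega lambda).
Local Notation energy := (energy Omega).
Local Notation J := (J Omega f lambda).
Local Notation dJ := (dJ Omega f lambda).
Let mOmega := domain_measurable oOmega.
Let fOmega := domain_fin oOmega bOmega.
Let ssqi a : is_smooth a -> sqi a. Proof. exact: smooth_sqi. Qed.
Let sintg a : is_smooth a -> intg a. Proof. exact: smooth_intg. Qed.
Let psqi i a : is_smooth a -> sqi (partial i a).
Proof. by move=> sa; apply: ssqi; exact: is_smooth_partial. Qed.

Lemma quarter_half (k : nat) : (4^-1 : R) ^+ k = (2^-1 ^+ k) ^+ 2.
Proof. by rewrite -exprM mulnC exprM; congr (_ ^+ k); field. Qed.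

Lemma half_exp_gt0 (k : nat) : 0 < (2^-1 : R) ^+ k.
Proof. by rewrite exprn_gt0// invr_gt0. Qed.

Lemma half_exp_le1 (k : nat) : (2^-1 : R) ^+ k <= 1.
Proof. by rewrite exprn_ile1 ?invr_ge0// invf_le1// ler1n. Qed.

Lemma cvg_half_exp (K : R) : (fun k => K * 2^-1 ^+ k : R) @ \oo --> (0 : R).
Proof. by apply: cvg_geometric; rewrite ger0_norm ?invr_ge0// invf_lt1// ltr1n. Qed.

Lemma energy_ge i a : nrm2 (partial i a) ^+ 2 <= energy a.
Proof.
rewrite sqr_nrm2 /energy (bigD1 i)//= lerDl sumr_ge0// => j _.
exact: int_sq_ge0.
Qed.

(* dJ (phi k) w tends to 0 since m <= J (phi k +- 2^-k w), while phi k is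
   4^-k-close to the infimum m. *)
Lemma weak_limit : exists (phi : nat -> 'rV[R]_n -> R) u (g : 'I_n -> 'rV[R]_n -> R)
    (C K4 : R),
  [/\ forall k, Cc (phi k),
      sqi u /\ (forall i, sqi (g i)),
      {ae mu, forall x, Omega x -> phi k x @[k --> \oo] --> u x},
      (forall k, nrm2 (fun x => phi k x - u x) <= C * 2^-1 ^+ k) /\
      (forall i k, nrm2 (fun x => partial i (phi k) x - g i x) <= C * 2^-1 ^+ k) &
      (forall k, int (fun x => phi k x ^+ 4) <= K4) /\
      (forall w, Cc w -> (fun k => dJ (phi k) w) @ \oo --> (0 : R))].
Proof.
have [c [c0 cP]] := quad_coercive oOmega bOmega lambda_lt.
have J4 phi : Cc phi ->
    4^-1 * int (fun x => phi x ^+ 4) - nrm2 f ^+ 2 / (2 * c) <= J phi.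
  by move=> Cphi; apply: (J_lower oOmega bOmega sf c0 Cphi); exact: cP.
have i40 a : 0 <= int (fun x => a x ^+ 4).
  by apply: Rintegral_ge0 => x _; rewrite (exprM _ 2 2) sqr_ge0.
have [m [phi [Cphi mJ Jm]]] : exists m (phi : nat -> 'rV[R]_n -> R),
    [/\ forall k, Cc (phi k), forall psi, Cc psi -> m <= J psi &
      forall k, J (phi k) <= m + 4^-1 ^+ k].
  apply: (@minimizing_sequence _ _ _ _ _ (- (nrm2 f ^+ 2 / (2 * c)))) => psi Cpsi.
  by have := J4 _ Cpsi; have := i40 psi; lra.
have sphi k := Cc_smooth_smooth (Cphi k).
(* The midpoint inequality bounds [quad] of the k-th increment by a multiple of 4^-k, for which 8 is
   large enough; coercivity divides by c, and the square root passes to the norm. *)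
pose C := Num.sqrt (8 / c).
have C2 : C ^+ 2 = 8 / c by rewrite sqr_sqrtr// divr_ge0// ltW.
have C0 : 0 <= C by exact: sqrtr_ge0.
pose dl k x := 1 * phi k.+1 x + -1 * phi k x.
have Cdl k : Cc (dl k) by exact: Cc_smooth_lin.
have qd k : quad (dl k) <= 8 * 4^-1 ^+ k.
  have := J_midpoint oOmega bOmega lambda sf (sphi k.+1) (sphi k).
  have := mJ _ (Cc_smooth_lin 2^-1 2^-1 (Cphi k.+1) (Cphi k)).
  have := Jm k; have := Jm k.+1; rewrite exprS -/(dl k).
  have : 0 <= 4^-1 ^+ k :> R by rewrite exprn_ge0// invr_ge0.
  by lra.
have bd k : nrm2 (dl k) ^+ 2 + energy (dl k) <= (C * 2^-1 ^+ k) ^+ 2.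
  rewrite sqr_nrm2 exprMn C2 -quarter_half mulrAC ler_pdivlMr// mulrC.
  exact: le_trans (cP _ (Cdl k)) (qd k).
have nn (x y : R) : 0 <= x -> 0 <= y -> x ^+ 2 <= y ^+ 2 -> x <= y.
  by move=> x0 y0; rewrite ler_pXn2r.
have Ch k : 0 <= C * 2^-1 ^+ k by rewrite mulr_ge0// ltW// half_exp_gt0.
have inc k : nrm2 (fun x => phi k.+1 x - phi k x) <= C * 2^-1 ^+ k.
  apply: nn => //; first exact: nrm2_ge0.
  rewrite (@eq_nrm2 _ _ _ _ _ _ (dl k)); last first.
    by move=> x _; rewrite /dl mul1r mulN1r.
  by apply: le_trans (bd k); rewrite lerDl energy_ge0.
have dinc i k : nrm2 (fun x => partial i (phi k.+1) x - partial i (phi k) x) <= C * 2^-1 ^+ k.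
  apply: nn => //; first exact: nrm2_ge0.
  rewrite (@eq_nrm2 _ _ _ _ _ _ (partial i (dl k))); last first.
    by move=> x _; rewrite (partial_lin _ _ _ (sphi k.+1) (sphi k)) mul1r mulN1r.
  apply: le_trans (bd k); apply: le_trans (energy_ge i (dl k)) _.
  by rewrite lerDr sqr_ge0.
have [u [su ae_u uC]] := riesz_fischer mOmega fOmega (fun k => ssqi (sphi k)) inc.
have [g gP] := choice (fun i => riesz_fischer mOmega fOmega
  (fun k => psqi i (sphi k)) (dinc i)).
have B k : nrm2 (phi k) <= 2 * C + nrm2 u.
  have := nrm2D mOmega (sqiB mOmega (ssqi (sphi k)) su) su.
  rewrite (@eq_nrm2 _ _ _ _ _ _ (phi k)); last by move=> x _; rewrite subrK.
  move=> /le_trans; apply; rewrite lerD2r; apply: le_trans (uC k) _.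
  by rewrite ler_piMr ?half_exp_le1// mulr_ge0.
(* The factor 2 comes from summing the increments in [riesz_fischer]; the L^4 constant comes from
   the lower bound on [J] together with J (phi k) <= m + 1. *)
exists phi, u, g, (2 * C), (4 * (m + 1 + nrm2 f ^+ 2 / (2 * c))); split => //.
- by split => // i; case: (gP i).
- by split => // i k; case: (gP i).
split.
  move=> k; have := J4 _ (Cphi k); have := Jm k; rewrite quarter_half.
  have : (2^-1 ^+ k) ^+ 2 <= 1 :> R.
    by rewrite exprn_ile1 ?half_exp_le1// ltW// half_exp_gt0.
  by lra.
move=> w Cw; have sw := Cc_smooth_smooth Cw.
have [M [M0 wM]] := smooth_bounded bOmega sw.
(* A bound, uniform in k, for the coefficient of t^2 in [J_expand]: the mixed term is at most M^2
   times the squared L^2 norm of phi k. *)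
pose K := `|2^-1 * quad w| + 2 * (M * (2 * C + nrm2 u)) ^+ 2 + int (fun x => w x ^+ 4).
apply: (@cvg_dist_le _ _ (fun k => (1 + K) * 2^-1 ^+ k)); last exact: cvg_half_exp.
move=> k; rewrite subr0.
have i22 : int (fun x => phi k x ^+ 2 * w x ^+ 2) <= (M * (2 * C + nrm2 u)) ^+ 2.
  rewrite (_ : Rintegral _ _ _ = nrm2 (fun x => w x * phi k x) ^+ 2); last first.
    by rewrite sqr_nrm2; apply: eq_Rintegral => x _; rewrite exprMn mulrC.
  rewrite lerXn2r ?nnegrE ?nrm2_ge0//.
    by rewrite mulr_ge0// addr_ge0 ?nrm2_ge0// mulr_ge0.
  have := nrm2_bddM mOmega (smooth_measurable sw) wM M0 (ssqi (sphi k)).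
  by move=> /le_trans; apply; rewrite ler_wpM2l.
pose h : R := 2^-1 ^+ k; have h0 : 0 < h by exact: half_exp_gt0.
have h1 : h <= 1 by exact: half_exp_le1.
have tst t : t ^+ 2 = h ^+ 2 -> `|t| <= 1 -> - (t * dJ (phi k) w) <= h ^+ 2 * (1 + K).
  move=> th t1; have := J_expand oOmega bOmega lambda sf (sphi k) sw t1.
  have := mJ _ (Cc_smooth_lin 1 t (Cphi k) Cw).
  have := Jm k; rewrite quarter_half -/h th.
  have : 2^-1 * quad w + 2 * int (fun x => phi k x ^+ 2 * w x ^+ 2) +
      int (fun x => w x ^+ 4) <= K.
    by rewrite /K lerD2r lerD ?ler_norm// ler_pM2l.
  move: (_ + int (fun x => w x ^+ 4)) => K' K'K.
  have : h ^+ 2 * K' <= h ^+ 2 * K by rewrite ler_pM2l// exprn_gt0.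
  move: (J _) (J _) (dJ _ _) => *; lra.
have := tst h erefl; have := tst (- h) (sqrrN h).
rewrite normrN (ger0_norm (ltW h0)) => /(_ h1) + /(_ h1).
rewrite mulNr opprK expr2 -mulrA ler_pM2l// -mulrN ler_pM2l// => d1 d2.
by rewrite ler_norml lerNl -/h [(1 + K) * h]mulrC d1 d2.
Qed.

End minimizer.

Lemma cvg_seq_unique (R : realType) (s : nat -> R) (a b : R) :
  s @ \oo --> a -> s @ \oo --> b -> a = b.
Proof. by move=> sa sb; exact: (cvg_unique (@norm_hausdorff _ _) sa sb). Qed.

Lemma cvg_sum_seq (R : realType) I (r : seq I) (s : I -> nat -> R) (a : I -> R) :
  (forall i, s i @ \oo --> a i) ->
  (fun k => \sum_(i <- r) s i k) @ \oo --> \sum_(i <- r) a i.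
Proof.
move=> sa; elim: r => [|i r ih].
  by rewrite big_nil; under eq_fun do rewrite big_nil; exact: cvg_cst.
by rewrite big_cons; under eq_fun do rewrite big_cons; exact: cvgD.
Qed.

(** * The weak equation *)

Section bracket_inequalities.
Context {R : realFieldType}.
Implicit Types t s : R.

(** Here and below the hypotheses say s = (1 + t^2)^(-1/2). Thus t s is a smooth substitute for the
    sign of t, and (1 + t^2) s one for |t|. *)
Lemma bracket_abs_le t s : 0 < s -> (1 + t ^+ 2) * s ^+ 2 = 1 -> `|t| * s <= 1.
Proof.
move=> s0 E; have t0 := normr_ge0 t.
have : (`|t| * s) ^+ 2 <= 1 ^+ 2.
  by rewrite exprMn real_normK ?num_real// expr1n; have := sqr_ge0 s; lra.
by rewrite ler_pXn2r ?nnegrE//; apply: mulr_ge0 => //; exact: ltW.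
Qed.

Lemma bracket_inv t s : 0 < s -> (1 + t ^+ 2) * s ^+ 2 = 1 -> (1 + t ^+ 2) * s = s^-1.
Proof.
move=> s0 E; have s0' : s != 0 by rewrite gt_eqF.
by apply: (mulIf s0'); rewrite -mulrA -expr2 E mulVf.
Qed.

Lemma bracket_le t s : 0 < s -> (1 + t ^+ 2) * s ^+ 2 = 1 ->
  `|t| <= (1 + t ^+ 2) * s <= 1 + `|t|.
Proof.
move=> s0 E; rewrite bracket_inv//; apply/andP; split.
  by rewrite -[s^-1]mul1r ler_pdivlMr// bracket_abs_le.
rewrite -[s^-1]mul1r ler_pdivrMr//.
have t0 := normr_ge0 t.
have : 1 ^+ 2 <= ((1 + `|t|) * s) ^+ 2.
  rewrite exprMn expr1n -[leLHS]E; apply: ler_wpM2r; first exact: sqr_ge0.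
  by rewrite -[t ^+ 2]real_normK ?num_real//; lra.
rewrite ler_pXn2r ?nnegrE//; apply: mulr_ge0; [exact: addr_ge0|exact: ltW].
Qed.

Lemma bracket_ge1 t s : 0 < s -> s <= 1 -> (1 + t ^+ 2) * s ^+ 2 = 1 ->
  1 <= (1 + t ^+ 2) * s.
Proof. by move=> s0 s1 E; rewrite bracket_inv// invf_ge1. Qed.

(** Smoothing the sign in |t|^3 = t^3 sgn(t) loses at most |t|. With a = |t| this reduces to a^2 - 1
    <= a^3 s, which for a > 1 is checked by squaring: it becomes a^4 + a^2 - 1 >= 0. *)
Lemma bracket_pow4_ge t s : 0 < s -> (1 + t ^+ 2) * s ^+ 2 = 1 ->
  `|t| ^+ 3 - `|t| <= t ^+ 4 * s.
Proof.
move=> s0 E; have -> : t ^+ 4 = `|t| ^+ 4.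
  by rewrite (exprM _ 2 2) (exprM `|t| 2 2) real_normK ?num_real.
move: E; rewrite -[t ^+ 2]real_normK ?num_real//; have := normr_ge0 t.
move: `|t| => {t}a a0 E.
have -> : a ^+ 3 - a = a * (a ^+ 2 - 1) by ring.
have -> : a ^+ 4 * s = a * (a ^+ 3 * s) by ring.
apply: ler_wpM2l => //; have as0 : 0 <= a ^+ 3 * s by rewrite mulr_ge0 ?exprn_ge0// ltW.
have [a1|a1] := leP (a ^+ 2 - 1) 0; first exact: le_trans as0.
rewrite -(@ler_pXn2r _ 2)// ?nnegrE//; last exact: ltW.
have d0 : 0 < 1 + a ^+ 2 by rewrite ltr_pwDl// sqr_ge0.
rewrite -(ler_pM2l d0).
have -> : (1 + a ^+ 2) * (a ^+ 3 * s) ^+ 2 = a ^+ 6 * ((1 + a ^+ 2) * s ^+ 2) by ring.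
rewrite E mulr1 -subr_ge0.
have -> : a ^+ 6 - (1 + a ^+ 2) * (a ^+ 2 - 1) ^+ 2 = a ^+ 2 * (a ^+ 2 - 1) + 2 * a ^+ 2 - 1.
  by ring.
have a2 : 0 <= a ^+ 2 * (a ^+ 2 - 1) by rewrite mulr_ge0 ?sqr_ge0// ltW.
by lra.
Qed.

Lemma oppr_split_le (x y z a b : R) : - x <= a -> y <= b -> 0 <= z ->
  - (x - y + z) <= a + b.
Proof. by lra. Qed.

Lemma weak_form_le (s l x r a b c p : R) : s - l + x = r -> r <= a -> l <= b ->
  - s <= c + p -> x <= a + b + c + p.
Proof. by lra. Qed.

(** For a = |u|, b = |v|, F = u^4 / sqrt (1 + u^2) and H = sqrt (1 + v^2): write a^3 b <= a^3 (H -
    1) + a^3, replace a^3 by F + a in the first product, and use H - 1 <= b. *)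
Lemma kato_pointwise (a b F H : R) : a ^+ 3 - a <= F -> b <= H -> H <= 1 + b -> 1 <= H ->
  0 <= a -> 0 <= b -> a ^+ 3 * b <= F * (H - 1) + a * b + a ^+ 3.
Proof.
move=> aF bH Hb H1 a0 b0.
have a30 : 0 <= a ^+ 3 by rewrite exprn_ge0.
have h1 : (a ^+ 3 - a) * (H - 1) <= F * (H - 1) by rewrite ler_wpM2r// subr_ge0.
have h2 : a * (H - 1) <= a * b by rewrite ler_wpM2l//; lra.
have h3 : a ^+ 3 * b <= a ^+ 3 * H by rewrite ler_wpM2l.
by lra.
Qed.

(** If a > b, then K = (|c| + 1) / (a - b) gives K (a - b) = |c| + 1 > c. *)
Lemma le_of_scaled (a b c : R) : (forall K, 0 < K -> K * a <= K * b + c) -> a <= b.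
Proof.
move=> h; rewrite leNgt; apply/negP => ba; have d0 : 0 < a - b by rewrite subr_gt0.
have := h ((`|c| + 1) / (a - b)) (divr_gt0 (ltr_pwDr ltr01 (normr_ge0 c)) d0).
rewrite -lerBlDl -mulrBr divfK ?gt_eqF//; have := ler_norm c; lra.
Qed.

End bracket_inequalities.

(** * The limit equation, the Kato estimate and its extension to H^1_0 *)

Section weak_solution.
Context {R : realType} {n : nat} (Omega : set 'rV[R]_n).
Hypotheses (oOmega : open Omega) (bOmega : bounded_set Omega).
Variables (f : 'rV[R]_n -> R) (lambda : R).
Hypothesis sf : sqi (lebesgue_rV n) Omega f.
Implicit Types (psi w a b v : 'rV[R]_n -> R) (i : 'I_n).

Local Notation mu := (lebesgue_rV n).
Local Notation Cc := (Cc_smooth Omega).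
Local Notation intg f := (mu.-integrable Omega (fun x => (f x)%:E)).
Local Notation int f := (\int[mu]_(x in Omega) f x).
Local Notation nrm2 := (nrm2 mu Omega).
Local Notation sqi := (sqi mu Omega).
Local Notation dJ := (dJ Omega f lambda).
Let mOmega := domain_measurable oOmega.
Let fOmega := domain_fin oOmega bOmega.
Let ssqi a : is_smooth a -> sqi a. Proof. exact: smooth_sqi. Qed.
Let sintg a : is_smooth a -> intg a. Proof. exact: smooth_intg. Qed.
Let psqi i a : is_smooth a -> sqi (partial i a).
Proof. by move=> sa; apply: ssqi; exact: is_smooth_partial. Qed.

Variables (phi : nat -> 'rV[R]_n -> R) (u : 'rV[R]_n -> R)
  (g : 'I_n -> 'rV[R]_n -> R) (C K4 : R).
Hypothesis Cphi : forall k, Cc (phi k).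
Hypothesis su : sqi u.
Hypothesis sg : forall i, sqi (g i).
Hypothesis ae_u : {ae mu, forall x, Omega x -> phi k x @[k --> \oo] --> u x}.
Hypothesis phi_u : forall k, nrm2 (fun x => phi k x - u x) <= C * 2^-1 ^+ k.
Hypothesis phi_g : forall i k,
  nrm2 (fun x => partial i (phi k) x - g i x) <= C * 2^-1 ^+ k.
Hypothesis phi4 : forall k, int (fun x => phi k x ^+ 4) <= K4.
Hypothesis dJ0 : forall w, Cc w -> (fun k => dJ (phi k) w) @ \oo --> (0 : R).

Let sphi k : is_smooth (phi k). Proof. exact: Cc_smooth_smooth (Cphi k). Qed.
Let measurable_u : measurable_fun Omega u. Proof. exact: su.1. Qed.

Let C0 : 0 <= C.
Proof. by have := phi_u 0; rewrite expr0 mulr1; apply: le_trans; exact: nrm2_ge0. Qed.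

Let cvg_rate (s : nat -> R) : (forall k, s k <= C * 2^-1 ^+ k) -> (forall k, 0 <= s k) ->
  s @ \oo --> (0 : R).
Proof.
move=> sC s0; apply: (@cvg_dist_le _ _ (fun k => C * 2^-1 ^+ k)).
  by move=> k; rewrite subr0 ger0_norm.
exact: cvg_half_exp.
Qed.

Lemma cvg_int_u w : sqi w ->
  (fun k => int (fun x => phi k x * w x)) @ \oo --> int (fun x => u x * w x).
Proof.
move=> sw; apply: cvg_int_nrm2 => //; first by move=> k; exact: ssqi.
by apply: cvg_rate => // k; exact: nrm2_ge0.
Qed.

Lemma cvg_int_g i w : sqi w ->
  (fun k => int (fun x => partial i (phi k) x * w x)) @ \oo --> int (fun x => g i x * w x).
Proof.
move=> sw; apply: cvg_int_nrm2 => //; first by move=> k; exact: psqi.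
by apply: cvg_rate => // k; exact: nrm2_ge0.
Qed.

(** For phi_k the identity is a classical integration by parts; both sides are L^2 pairings with a
    fixed smooth function and pass to the limit. *)
Lemma limit_weak_partial i : is_weak_partial Omega i u (g i).
Proof.
move=> psi Cpsi; have spsi := Cc_smooth_smooth Cpsi.
apply: (cvg_seq_unique (cvg_int_u (psqi i spsi))).
rewrite (_ : (fun k => _) =
    fun k => - int (fun x => partial i (phi k) x * psi x)); last first.
  by apply/funext => k; exact: Cc_smooth_parts.
by apply: cvgN; apply: cvg_int_g; exact: ssqi.
Qed.

Lemma limit_pow4 : intg (fun x => u x ^+ 4) /\ int (fun x => u x ^+ 4) <= K4.
Proof.
have p4 (t : R) : 0 <= t ^+ 4 by rewrite (exprM _ 2 2) sqr_ge0.
apply: (@fatou_ae _ _ _ _ _ mOmega (fun k x => phi k x ^+ 4) _ (cst K4)) => //.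
- by move=> k; apply: sintg; exact: is_smoothX.
- exact: measurable_funX.
- apply: filterS ae_u => x /[apply] xu.
  by apply: (cvg_comp (fun k => phi k x) (fun y => y ^+ 4)); last exact: exprn_continuous.
- exact: cvg_cst.
Qed.

Lemma limit_sqr_sqi : sqi (fun x => u x ^+ 2).
Proof.
split; first exact: measurable_funX.
by under eq_fun do rewrite -exprM; exact: limit_pow4.1.
Qed.

Lemma limit_pow3_intg : intg (fun x => u x ^+ 3).
Proof.
apply: (le_intg mOmega _ _ (intgD mOmega su.2 limit_pow4.1)).
  exact: measurable_funX.
move=> x _; move: (u x) => t; have [h1 h2] := (sqr_ge0 (t ^+ 2 + t), sqr_ge0 (t ^+ 2 - t)).
have t2 := sqr_ge0 t; have t4 := sqr_ge0 (t ^+ 2).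
have E1 : (t ^+ 2 + t) ^+ 2 = t ^+ 4 + 2 * t ^+ 3 + t ^+ 2 by ring.
have E2 : (t ^+ 2 - t) ^+ 2 = t ^+ 4 - 2 * t ^+ 3 + t ^+ 2 by ring.
have E4 : (t ^+ 2) ^+ 2 = t ^+ 4 by ring.
by rewrite ler_norml; apply/andP; split; lra.
Qed.

Lemma limit_pow3M_intg w M : measurable_fun Omega w ->
  (forall x, Omega x -> `|w x| <= M) -> intg (fun x => u x ^+ 3 * w x).
Proof.
move=> mw wM; under eq_fun do rewrite mulrC.
exact: (intg_bddM mOmega mw wM limit_pow3_intg).
Qed.

(** Factor A^3 - D^3 = (A - D) (A^2 + A D + D^2): the first factor tends to 0 in L^2, the second
    stays bounded in L^2 by the L^4 bounds. *)
Lemma cvg_int_pow3 w : is_smooth w ->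
  (fun k => int (fun x => phi k x ^+ 3 * w x)) @ \oo --> int (fun x => u x ^+ 3 * w x).
Proof.
move=> sw; have [M [M0 wM]] := smooth_bounded bOmega sw.
have mw := smooth_measurable sw : measurable_fun Omega w.
(* The 3 / 2 comes from |A^2 + A D + D^2| <= 3 / 2 (A^2 + D^2). *)
pose B := 3 / 2 * M * (Num.sqrt K4 + nrm2 (fun x => u x ^+ 2)).
apply: (@cvg_dist_le _ _ (fun k => (C * B) * 2^-1 ^+ k)); last exact: cvg_half_exp.
move=> k; have sp2 : sqi (fun x => phi k x ^+ 2) by apply: ssqi; exact: is_smoothX.
pose s x := 3 / 2 * M * (phi k x ^+ 2 + u x ^+ 2).
have ss : sqi s by apply: sqiZ => //; apply: sqiD => //; exact: limit_sqr_sqi.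
pose q x := (phi k x ^+ 2 + phi k x * u x + u x ^+ 2) * w x.
have mphi : measurable_fun Omega (phi k) by exact: smooth_measurable.
have mq : measurable_fun Omega q.
  apply: measurable_funM => //; apply: measurable_funD; last exact: measurable_funX.
  by apply: measurable_funD; [exact: measurable_funX|exact: measurable_funM].
have qs x : Omega x -> `|q x| <= `|s x|.
  move=> Ox; rewrite normrM [`|s x|]ger0_norm; last first.
    by rewrite /s !mulr_ge0// addr_ge0 ?sqr_ge0.
  rewrite /s mulrAC; apply: ler_pM => //; last exact: wM.
  move: (phi k x) (u x) => A D; have [h1 h2] := (sqr_ge0 (A + D), sqr_ge0 (A - D)).
  have [h3 h4] := (sqr_ge0 A, sqr_ge0 D).
  have E1 : (A + D) ^+ 2 = A ^+ 2 + 2 * (A * D) + D ^+ 2 by ring.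
  have E2 : (A - D) ^+ 2 = A ^+ 2 - 2 * (A * D) + D ^+ 2 by ring.
  by rewrite ler_norml; apply/andP; split; lra.
have sq : sqi q by exact: sqi_le qs ss.
have -> : int (fun x => phi k x ^+ 3 * w x) - int (fun x => u x ^+ 3 * w x) =
    int (fun x => (phi k x - u x) * q x).
  rewrite -RintegralB//=.
  - by apply: eq_Rintegral => x _; rewrite /q; ring.
  - by apply: sintg; apply: is_smoothM => //; exact: is_smoothX.
  - exact: limit_pow3M_intg wM.
apply: le_trans (cauchy_schwarz_norm mOmega (sqiB mOmega (ssqi (sphi k)) su) sq) _.
rewrite mulrAC; apply: ler_pM; [exact: nrm2_ge0|exact: nrm2_ge0|exact: phi_u|].
apply: le_trans (nrm2_le mOmega mq qs ss) _.
rewrite /s nrm2Z//; last by apply: sqiD => //; exact: limit_sqr_sqi.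
rewrite ger0_norm ?mulr_ge0//; apply: ler_wpM2l; first by rewrite !mulr_ge0.
apply: le_trans (nrm2D mOmega sp2 limit_sqr_sqi) _; rewrite lerD2r.
apply: ler_wsqrtr; apply: le_trans (phi4 k).
by under eq_Rintegral do rewrite -exprM.
Qed.

Lemma weak_equation w : Cc w ->
  \sum_(i < n) int (fun x => g i x * partial i w x)
    - lambda * int (fun x => u x * w x) + int (fun x => u x ^+ 3 * w x)
  = int (fun x => f x * w x).
Proof.
move=> Cw; have sw := Cc_smooth_smooth Cw; apply/eqP; rewrite -subr_eq0; apply/eqP.
apply: cvg_seq_unique (dJ0 Cw); rewrite /dJ /bil.
apply: cvgB; last exact: cvg_cst.
apply: cvgD; last exact: cvg_int_pow3.
apply: cvgB.
  by apply: cvg_sum_seq => i; apply: cvg_int_g; exact: psqi.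
by apply: cvgM; [exact: cvg_cst|apply: cvg_int_u; exact: ssqi].
Qed.

Lemma limit_H1_norm_small (e : R) : 0 < e -> exists k,
  H1_norm Omega (fun x => u x - phi k x) (fun i x => g i x - partial i (phi k) x) < e.
Proof.
(* One term for the function and n for its derivatives, each at most C^2 4^-k <= C^2 2^-k. *)
move=> e0; pose K := n.+1%:R * C ^+ 2.
have [k ke] : exists k, K * 2^-1 ^+ k < e ^+ 2.
  have /cvgr0_norm_lt/(_ _ (exprn_gt0 2 e0))[N _ /(_ N (leqnn N))] := cvg_half_exp K.
  by move=> /= NK; exists N; exact: le_lt_trans (ler_norm _) NK.
exists k; rewrite /H1_norm -[ltRHS](gtr0_norm e0) -sqrtr_sqr ltr_sqrt ?exprn_gt0//.
apply: le_lt_trans ke; pose h : R := 2^-1 ^+ k.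
have h0 : 0 < h by exact: half_exp_gt0.
have hb a b : nrm2 (fun x => b x - a x) <= C * h ->
    int (fun x => (a x - b x) ^+ 2) <= C ^+ 2 * h.
  move=> abC; rewrite -sqr_nrm2 nrm2BC.
  apply: (@le_trans _ _ ((C * h) ^+ 2)).
    by rewrite lerXn2r ?nnegrE ?nrm2_ge0// mulr_ge0// ltW.
  rewrite exprMn ler_wpM2l ?sqr_ge0// expr2 ler_piMr ?half_exp_le1//.
  exact: ltW.
rewrite /K -mulrA mulr_natl mulrS; apply: lerD; first exact: hb (phi_u k).
rewrite -[in leRHS](card_ord n) -sumr_const; apply: ler_sum => i _.
exact: hb (phi_g i k).
Qed.

(** Linear in the L^2 norms of [v] and its derivatives, hence homogeneous. The last [nrm2 u] in the
    bracket pays for the loss |u| |v| of the smoothing. *)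
Definition kato_bound v := (nrm2 f + `|lambda| * nrm2 u + nrm2 u) * nrm2 v +
  \sum_(i < n) nrm2 (g i) * nrm2 (partial i v).

(* Tests the equation with w k = H * phi k / sqrt (1 + (phi k)^2), where
   H = sqrt (1 + v^2) - 1 is a smooth substitute for |v|. *)
Lemma kato_bracket v : Cc v ->
  intg (fun x => u x ^+ 4 * ijb u x * ((1 + v x ^+ 2) * ijb v x - 1)) /\
  int (fun x => u x ^+ 4 * ijb u x * ((1 + v x ^+ 2) * ijb v x - 1)) <=
  (nrm2 f + `|lambda| * nrm2 u) * nrm2 v +
  \sum_(i < n) nrm2 (g i) * nrm2 (partial i v).
Proof.
move=> Cv; have sv := Cc_smooth_smooth Cv.
pose H x := (1 + v x ^+ 2) * ijb v x - 1.
have sH : is_smooth H.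
  apply: is_smoothD; last exact: is_smooth_cst.
  apply: is_smoothM; last exact: is_smooth_ijb.
  by apply: is_smoothD; [exact: is_smooth_cst|exact: is_smoothX].
have H0 x : 0 <= H x.
  by rewrite subr_ge0 bracket_ge1 ?ijb_gt0 ?ijb_le1 ?sqr_ijb.
have Hv x : `|H x| <= `|v x|.
  rewrite ger0_norm// lerBlDl.
  by have /andP[] := bracket_le (ijb_gt0 v x) (sqr_ijb v x).
have CH : Cc H.
  apply: (Cc_smooth_sub Cv sH) => x v0; apply/eqP; rewrite -normr_le0.
  by apply: le_trans (Hv x) _; rewrite v0 normr0.
(* The derivative of sqrt (1 + v^2) is v / sqrt (1 + v^2) times that of v, and this factor is at
   most 1 in absolute value. *)
have dH i x : `|partial i H x| <= `|partial i v x|.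
  have -> : partial i H x = v x * ijb v x * partial i v x.
    have dv : derivable v x (delta_mx ord0 i) by exact: is_smooth_derivable.
    have sv2 : is_smooth (fun y => 1 + v y ^+ 2).
      by apply: is_smoothD; [exact: is_smooth_cst|exact: is_smoothX].
    have dv2 : partial i (fun y => 1 + v y ^+ 2) x = 2 * v x * partial i v x.
      under [X in partial i X]eq_fun do rewrite expr2.
      rewrite partialD; [|exact: is_smooth_derivable (@is_smooth_cst R n 1)|].
        by rewrite partial_cst partialM//; ring.
      by apply: is_smooth_derivable; exact: is_smoothM.
    rewrite partialD; last 2 first.
    - apply: is_smooth_derivable; apply: is_smoothM => //; exact: is_smooth_ijb.
    - exact: is_smooth_derivable (@is_smooth_cst R n (-1)).
    rewrite partial_cst addr0 partialM; last 2 first.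
    - exact: is_smooth_derivable.
    - by apply: is_smooth_derivable; exact: is_smooth_ijb.
    rewrite dv2 partial_ijb//.
    have -> : (1 + v x ^+ 2) * - (v x * partial i v x * ijb v x ^+ 3) =
        - (v x * partial i v x * ijb v x * ((1 + v x ^+ 2) * ijb v x ^+ 2)) by ring.
    by rewrite sqr_ijb; ring.
  rewrite normrM ler_piMl// normrM (ger0_norm (ltW (ijb_gt0 v x))).
  exact: bracket_abs_le (ijb_gt0 v x) (sqr_ijb v x).
have [M [M0 HM]] := smooth_bounded bOmega sH.
pose w k x := H x * (phi k x * ijb (phi k) x).
have sb k : is_smooth (fun x => phi k x * ijb (phi k) x).
  by apply: is_smoothM => //; exact: is_smooth_ijb.
have Cw k : Cc (w k) by exact: Cc_smoothM.
have b1 (t : R) s : 0 < s -> (1 + t ^+ 2) * s ^+ 2 = 1 -> `|t * s| <= 1.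
  by move=> s0 E; rewrite normrM (ger0_norm (ltW s0)) bracket_abs_le.
have wH k x : `|w k x| <= H x.
  by rewrite normrM (ger0_norm (H0 x)) ler_piMr// b1 ?ijb_gt0 ?sqr_ijb.
have wv k x : Omega x -> `|w k x| <= `|v x|.
  by move=> _; apply: le_trans (wH k x) _; rewrite -(ger0_norm (H0 x)).
have sw k := Cc_smooth_smooth (Cw k).
(* The factor [ijb] ^ 3 is the derivative (1 + p^2)^(-3/2) of p / sqrt (1 + p^2). Its positivity
   gives the |grad phi_k|^2 term its favourable sign. *)
have dw i k x : partial i (w k) x = (phi k x * ijb (phi k) x) * partial i H x +
    H x * ijb (phi k) x ^+ 3 * partial i (phi k) x.
  have dp : derivable (phi k) x (delta_mx ord0 i) by exact: is_smooth_derivable.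
  rewrite partialM; last 2 first.
  - exact: is_smooth_derivable.
  - exact: is_smooth_derivable.
  rewrite partialM//; last by apply: is_smooth_derivable; exact: is_smooth_ijb.
  rewrite partial_ijb//.
  have -> : phi k x * - (phi k x * partial i (phi k) x * ijb (phi k) x ^+ 3) +
      ijb (phi k) x * partial i (phi k) x =
      partial i (phi k) x * (ijb (phi k) x * ((1 + phi k x ^+ 2) * ijb (phi k) x ^+ 2)
       - phi k x ^+ 2 * ijb (phi k) x ^+ 3).
    by rewrite sqr_ijb; ring.
  by ring.
pose A := (nrm2 f + `|lambda| * nrm2 u) * nrm2 v +
  \sum_(i < n) nrm2 (g i) * nrm2 (partial i v).
pose B := \sum_(i < n) C * (M * (C + nrm2 (g i))).
(* In the part of grad w_k that contains grad phi_k, g is written as grad phi_k minus (grad phi_k -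
   g). The first contributes a nonnegative integral, which is dropped; the second is O(2^-k) because
   H is bounded by M. *)
have gw i k : - int (fun x => g i x * partial i (w k) x) <=
    nrm2 (g i) * nrm2 (partial i v) + C * (M * (C + nrm2 (g i))) * 2^-1 ^+ k.
  have mij : measurable_fun Omega (fun x => H x * ijb (phi k) x ^+ 3).
    apply: smooth_measurable; apply: is_smoothM => //.
    by apply: is_smoothX; exact: is_smooth_ijb.
  have ijM x : Omega x -> `|H x * ijb (phi k) x ^+ 3| <= M.
    move=> Ox; rewrite normrM -[leRHS]mulr1 ler_pM ?HM//.
    by rewrite normrX exprn_ile1// ger0_norm ?ijb_le1// ltW// ijb_gt0.
  have s1 : sqi (fun x => (phi k x * ijb (phi k) x) * partial i H x).
    by apply: ssqi; apply: is_smoothM => //; exact: is_smooth_partial.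
  have s2 : sqi (fun x => H x * ijb (phi k) x ^+ 3 * partial i (phi k) x).
    by apply: (sqi_bddM mOmega mij ijM); exact: psqi.
  have sd : sqi (fun x => partial i (phi k) x - g i x) by apply: sqiB => //; exact: psqi.
  have i1 := sqi_mul mOmega (sg i) s1.
  have i2 := sqi_mul mOmega sd s2.
  have i3 := sqi_mul mOmega (psqi i (sphi k)) s2.
  have -> : int (fun x => g i x * partial i (w k) x) =
      int (fun x => g i x * ((phi k x * ijb (phi k) x) * partial i H x)) -
      int (fun x => (partial i (phi k) x - g i x) *
        (H x * ijb (phi k) x ^+ 3 * partial i (phi k) x)) +
      int (fun x => partial i (phi k) x * (H x * ijb (phi k) x ^+ 3 * partial i (phi k) x)).
    by apply: (Rintegral_split3 mOmega i1 i2 i3) => x; rewrite dw; ring.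
  have P0 : 0 <= int (fun x => partial i (phi k) x *
      (H x * ijb (phi k) x ^+ 3 * partial i (phi k) x)).
    apply: Rintegral_ge0 => x _.
    have -> : partial i (phi k) x * (H x * ijb (phi k) x ^+ 3 * partial i (phi k) x) =
      H x * ijb (phi k) x ^+ 3 * partial i (phi k) x ^+ 2 by ring.
    by rewrite mulr_ge0 ?sqr_ge0// mulr_ge0// exprn_ge0// ltW// ijb_gt0.
  have cs1 := cauchy_schwarz_norm mOmega (sg i) s1.
  have cs2 := cauchy_schwarz mOmega sd s2.
  have n1 : nrm2 (fun x => (phi k x * ijb (phi k) x) * partial i H x) <= nrm2 (partial i v).
    apply: (nrm2_le mOmega s1.1 _ (psqi i sv)) => x _.
    rewrite normrM; apply: le_trans (dH i x); rewrite ler_piMl//.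
    by rewrite b1 ?ijb_gt0 ?sqr_ijb.
  have n2 : nrm2 (fun x => H x * ijb (phi k) x ^+ 3 * partial i (phi k) x) <=
      M * (C + nrm2 (g i)).
    apply: le_trans (nrm2_bddM mOmega mij ijM M0 (psqi i (sphi k))) _.
    apply: ler_wpM2l => //.
    have := nrm2D mOmega sd (sg i).
    rewrite (@eq_nrm2 _ _ _ _ _ _ (partial i (phi k))); last by move=> x _; rewrite subrK.
    move=> /le_trans; apply; rewrite lerD2r; apply: le_trans (phi_g i k) _.
    by rewrite ler_piMr ?half_exp_le1.
  have n1' := ler_wpM2l (nrm2_ge0 mu Omega (g i)) n1.
  have n2' : nrm2 (fun x => partial i (phi k) x - g i x) *
      nrm2 (fun x => H x * ijb (phi k) x ^+ 3 * partial i (phi k) x) <=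
      C * (M * (C + nrm2 (g i))) * 2^-1 ^+ k.
    by rewrite [leRHS]mulrAC ler_pM ?nrm2_ge0.
  have cs1' := le_trans (ler_norm _) (eq_ind_r (fun y => y <= _) cs1 (normrN _)).
  have {}cs2 := le_trans cs2 n2'; have {}n1' := le_trans cs1' n1'.
  exact: oppr_split_le n1' cs2 P0.
have uw k : int (fun x => u x ^+ 3 * w k x) <= A + B * 2^-1 ^+ k.
  have := weak_equation (Cw k) => E.
  have nw : nrm2 (w k) <= nrm2 v.
    by apply: (nrm2_le mOmega _ (wv k) (ssqi sv)); exact: smooth_measurable.
  have cf : int (fun x => f x * w k x) <= nrm2 f * nrm2 v.
    apply: le_trans (cauchy_schwarz mOmega sf (ssqi (sw k))) _.
    by apply: ler_wpM2l => //; exact: nrm2_ge0.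
  have cl : lambda * int (fun x => u x * w k x) <= `|lambda| * nrm2 u * nrm2 v.
    apply: le_trans (ler_norm _) _; rewrite normrM -mulrA; apply: ler_wpM2l => //.
    apply: le_trans (cauchy_schwarz_norm mOmega su (ssqi (sw k))) _.
    by apply: ler_wpM2l => //; exact: nrm2_ge0.
  have gs : - \sum_(i < n) int (fun x => g i x * partial i (w k) x) <=
      \sum_(i < n) nrm2 (g i) * nrm2 (partial i v) + B * 2^-1 ^+ k.
    rewrite -sumrN /B mulr_suml -big_split; apply: ler_sum => i _; exact: gw.
  by rewrite /A mulrDl; exact: weak_form_le E cf cl gs.
have mH := smooth_measurable sH : measurable_fun Omega H.
have cb : continuous (ijb (id : R -> R)) by apply: continuous_ijb => t; exact: cvg_id.
have mj : measurable_fun Omega (ijb u).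
  apply: (measurableT_comp (f := ijb id)) => //.
  exact: continuous_measurable_fun.
have ju x : Omega x -> `|u x * ijb u x| <= 1.
  by move=> _; rewrite b1 ?ijb_gt0 ?sqr_ijb.
have iuw k : intg (fun x => u x ^+ 3 * w k x).
  apply: (limit_pow3M_intg (M := M)); first exact: smooth_measurable.
  by move=> x Ox; apply: le_trans (wH k x) _; rewrite -(ger0_norm (H0 x)) HM.
have iabs : intg (fun x => `|u x| ^+ 3 * H x).
  have := intg_norm (limit_pow3M_intg mH HM).
  apply: eq_integrable => // x _ /=.
  by rewrite normrM normrX (ger0_norm (H0 x)).
(* The integrands u^3 w_k have no sign. Adding |u|^3 H, which dominates them since |w_k| <= H, makes
   Fatou applicable; the added integral is finite and is subtracted afterwards. *)
pose F x := u x ^+ 4 * ijb u x * H x + `|u x| ^+ 3 * H x.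
have [Fi Fle] : intg F /\ int F <= int (fun x => `|u x| ^+ 3 * H x) + A.
  apply: (@fatou_ae _ _ _ _ _ mOmega (fun k x => u x ^+ 3 * w k x + `|u x| ^+ 3 * H x) _
    (fun k => int (fun x => `|u x| ^+ 3 * H x) + (A + B * 2^-1 ^+ k))).
  - by move=> k; apply: intgD.
  - apply: measurable_funD; last exact: intg_measurable iabs.
    by do 2 apply: measurable_funM => //; exact: measurable_funX.
  - move=> k x _; rewrite -[X in _ <= X + _]opprK addrC subr_ge0.
    apply: le_trans (ler_norm _) _; rewrite normrN normrM normrX.
    by rewrite ler_wpM2l ?exprn_ge0.
  - move=> x _; apply: addr_ge0; last by rewrite mulr_ge0// exprn_ge0.
    rewrite mulr_ge0// mulr_ge0//; first by rewrite (exprM _ 2 2) sqr_ge0.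
    by rewrite ltW// ijb_gt0.
  - apply: filterS ae_u => x /[apply] ux; apply: cvgD; last exact: cvg_cst.
    rewrite (_ : u x ^+ 4 * _ * _ = u x ^+ 3 * (H x * (u x * ijb u x))); last by ring.
    apply: cvgM; first exact: cvg_cst.
    apply: cvgM; first exact: cvg_cst.
    apply: cvgM => //.
    apply: (cvg_comp (fun k => phi k x) (ijb id) ux).
    exact: (cb (u x)).
  - move=> k; rewrite (RintegralD mOmega (iuw k) iabs) addrC lerD2l; exact: uw.
  - apply: cvgD; first exact: cvg_cst.
    rewrite -[X in _ --> X]addr0; apply: cvgD; first exact: cvg_cst.
    exact: cvg_half_exp.
have i4 : intg (fun x => u x ^+ 4 * ijb u x * H x).
  have := intgB mOmega Fi iabs; apply: eq_integrable => // x _ /=.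
  by rewrite /F addrK.
by split => //; move: Fle; rewrite /F (RintegralD mOmega i4 iabs) addrC lerD2l.
Qed.

Lemma limit_abs_pow3 : intg (fun x => `|u x| ^+ 3).
Proof.
have := intg_norm limit_pow3_intg; apply: eq_integrable => // x _ /=.
by rewrite normrX.
Qed.

Lemma limit_abs_pow3M v : is_smooth v -> intg (fun x => `|u x| ^+ 3 * `|v x|).
Proof.
move=> sv; have [M [_ vM]] := smooth_bounded bOmega sv.
have mv := smooth_measurable sv : measurable_fun Omega v.
have := intg_norm (limit_pow3M_intg mv vM); apply: eq_integrable => // x _ /=.
by rewrite normrM normrX.
Qed.

(** Undoing both smoothings by [kato_pointwise] costs |u| |v|, which Cauchy-Schwarz puts into
    [kato_bound], and |u|^3, which stays as a constant independent of [v]. *)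
Lemma kato_affine v : Cc v ->
  int (fun x => `|u x| ^+ 3 * `|v x|) <= kato_bound v + int (fun x => `|u x| ^+ 3).
Proof.
move=> Cv; have sv := Cc_smooth_smooth Cv; have [Fi FA] := kato_bracket Cv.
have uvi := sqi_mul mOmega (sqi_norm mOmega su) (sqi_norm mOmega (ssqi sv)).
have uv : int (fun x => `|u x| * `|v x|) <= nrm2 u * nrm2 v.
  rewrite -(nrm2_norm mu Omega u) -(nrm2_norm mu Omega v).
  by apply: cauchy_schwarz => //; apply: sqi_norm => //; exact: ssqi.
have Gi := intgD mOmega (intgD mOmega Fi uvi) limit_abs_pow3.
apply: (@le_trans _ _ (int (fun x =>
    u x ^+ 4 * ijb u x * ((1 + v x ^+ 2) * ijb v x - 1) + `|u x| * `|v x| + `|u x| ^+ 3))).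
  apply: le_Rintegral => //; first exact: limit_abs_pow3M.
  move=> x _; have h1 := bracket_pow4_ge (ijb_gt0 u x) (sqr_ijb u x).
  have /andP[h2 h3] := bracket_le (ijb_gt0 v x) (sqr_ijb v x).
  have h4 := bracket_ge1 (ijb_gt0 v x) (ijb_le1 v x) (sqr_ijb v x).
  exact: kato_pointwise h1 h2 h3 h4 (normr_ge0 _) (normr_ge0 _).
rewrite (RintegralD mOmega (intgD mOmega Fi uvi) limit_abs_pow3).
rewrite (RintegralD mOmega Fi uvi) lerD2r /kato_bound [X in _ <= X + _]mulrDl.
by rewrite addrAC; apply: lerD.
Qed.

Lemma kato_boundZ (c : R) v : is_smooth v ->
  kato_bound (fun x => c * v x) = `|c| * kato_bound v.
Proof.
move=> sv; rewrite /kato_bound (nrm2Z mOmega _ (ssqi sv)) mulrDr mulr_sumr mulrCA.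
congr (_ + _); apply: eq_bigr => i _.
rewrite mulrCA -(nrm2Z mOmega _ (psqi i sv)); congr (_ * _); apply: eq_nrm2 => x _.
by rewrite partialZ//; exact: is_smooth_derivable.
Qed.

(* The affine bound scales to a homogeneous one. *)
Lemma kato_le v : Cc v -> int (fun x => `|u x| ^+ 3 * `|v x|) <= kato_bound v.
Proof.
move=> Cv; have sv := Cc_smooth_smooth Cv.
apply: (@le_of_scaled _ _ _ (int (fun x => `|u x| ^+ 3))) => K K0.
have := kato_affine (Cc_smoothZ K Cv); rewrite kato_boundZ// (gtr0_norm K0).
rewrite -(RintegralZl _ mOmega (limit_abs_pow3M sv)); apply: le_trans.
rewrite le_eqVlt; apply/orP; left; apply/eqP; apply: eq_Rintegral => x _.
by rewrite normrM (gtr0_norm K0) mulrCA.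
Qed.

(** Let test functions psi_j tend to v in H^1. By [kato_le] on their differences they are Cauchy in
    L^1 with weight |u|^3, and Fatou transfers the estimate to v - psi_l. This gives both the
    integrability of u^3 v and the limit of the cubic terms. *)
Lemma H10_weak_equation (v : H1 Omega) : H10 v ->
  intg (fun x => u x ^+ 3 * v x) /\
  \sum_(i < n) int (fun x => g i x * weak_partial v i x)
    - lambda * int (fun x => u x * v x) + int (fun x => u x ^+ 3 * v x)
  = int (fun x => f x * v x).
Proof.
move=> v0; have sv : sqi v by apply/(L2_sqi mOmega); exact: H1_L2.
have sdv i : sqi (weak_partial v i) by apply/(L2_sqi mOmega); exact: weak_partial_L2.
have ex j : exists psi, Cc psi /\ (nrm2 (fun x => v x - psi x) <= 2^-1 ^+ j /\
    forall i, nrm2 (fun x => weak_partial v i x - partial i psi x) <= 2^-1 ^+ j).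
  have [psi Cpsi psij] := v0 _ (half_exp_gt0 j); exists psi; split => //.
  have N0 : 0 <= int (fun x => (v x - psi x) ^+ 2) by exact: int_sq_ge0.
  have S0 : 0 <= \sum_(i < n) int (fun x => (weak_partial v i x - partial i psi x) ^+ 2).
    by apply: sumr_ge0 => i _; exact: int_sq_ge0.
  split => [|i]; apply: le_trans (ltW psij); apply: ler_wsqrtr.
    by rewrite lerDl.
  rewrite (bigD1 i)//= addrCA lerDl addr_ge0// sumr_ge0// => k _.
  exact: int_sq_ge0.
have [psi psiP] := choice ex.
have Cpsi j : Cc (psi j) by case: (psiP j).
have spsi j := Cc_smooth_smooth (Cpsi j).
have psiv j : nrm2 (fun x => psi j x - v x) <= 2^-1 ^+ j.
  by rewrite nrm2BC; case: (psiP j) => _ [].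
have dpsiv i j : nrm2 (fun x => partial i (psi j) x - weak_partial v i x) <= 2^-1 ^+ j.
  by rewrite nrm2BC; case: (psiP j) => _ [].
have near2 a b c j l : sqi a -> sqi b -> sqi c ->
    nrm2 (fun x => a x - c x) <= 2^-1 ^+ j -> nrm2 (fun x => b x - c x) <= 2^-1 ^+ l ->
    nrm2 (fun x => a x - b x) <= 2^-1 ^+ j + 2^-1 ^+ l.
  move=> sa sb sc ac bc; apply: le_trans (nrm2_dist mOmega sa sc sb) _.
  by rewrite lerD// nrm2BC.
have half_cvg0 : (fun k => 2^-1 ^+ k : R) @ \oo --> (0 : R).
  by under eq_fun do rewrite -[_ ^+ _]mul1r; exact: cvg_half_exp.
(* Fatou needs pointwise convergence to v itself. The almost everywhere limit v' from
   [riesz_fischer] is also the L^2 limit, so it agrees with v almost everywhere. *)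
have ae_v : {ae mu, forall x, Omega x -> psi k x @[k --> \oo] --> v x}.
  have inc k : nrm2 (fun x => psi k.+1 x - psi k x) <= 2 * 2^-1 ^+ k.
    apply: le_trans (near2 _ _ _ _ _ (ssqi (spsi k.+1)) (ssqi (spsi k)) sv
      (psiv k.+1) (psiv k)) _.
    by rewrite exprS; have := @half_exp_gt0 R k; lra.
  have [v' [sv' ae_v' v'C]] := riesz_fischer mOmega fOmega (fun k => ssqi (spsi k)) inc.
  have vv' : nrm2 (fun x => v x - v' x) = 0.
    apply: (@cvg_seq_unique _ (fun _ => nrm2 (fun x => v x - v' x))).
      exact: cvg_cst.
    (* Of the 5, 1 bounds the distance from v to psi_k, and 4 = 2 * 2 is the [riesz_fischer]
       constant for increments of size 2 * 2^-k. *)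
    apply: (@cvg_dist_le _ _ (fun k => 5 * 2^-1 ^+ k)); last exact: cvg_half_exp.
    move=> k; rewrite subr0 ger0_norm ?nrm2_ge0//.
    apply: le_trans (nrm2_dist mOmega sv (ssqi (spsi k)) sv') _.
    by have := v'C k; have := psiv k; rewrite nrm2BC; lra.
  have int0 : int (fun x => (v x - v' x) ^+ 2) = 0 by rewrite -sqr_nrm2 vv' expr0n.
  have [md id] := sqiB mOmega sv sv'.
  have ae0 : ae_eq mu Omega (fun x => ((v x - v' x) ^+ 2)%:E) (cst 0%E).
    apply/(ae_eq_integral_abs mu mOmega); first exact: measurable_int id.
    under eq_integral do rewrite gee0_abs ?lee_fin ?sqr_ge0//.
    by rewrite -[LHS]fineK ?integrable_fin_num//; congr (_%:E).
  apply: filterS2 ae0 ae_v' => x vx ux Ox; have := vx Ox; have := ux Ox.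
  move=> + [] /eqP; rewrite sqrf_eq0 subr_eq0 => + /eqP ->.
  exact.
pose B := (nrm2 f + `|lambda| * nrm2 u + nrm2 u) + \sum_(i < n) nrm2 (g i).
have kB j l : kato_bound (fun x => 1 * psi j x + -1 * psi l x) <=
    B * (2^-1 ^+ j + 2^-1 ^+ l).
  rewrite /kato_bound /B [leRHS]mulrDl mulr_suml; apply: lerD.
    apply: ler_wpM2l; first by rewrite !addr_ge0 ?mulr_ge0 ?nrm2_ge0.
    rewrite (@eq_nrm2 _ _ _ _ _ _ (fun x => psi j x - psi l x)); last first.
      by move=> x _; rewrite mul1r mulN1r.
    exact: near2 (ssqi (spsi j)) (ssqi (spsi l)) sv (psiv j) (psiv l).
  apply: ler_sum => i _; apply: ler_wpM2l; first exact: nrm2_ge0.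
  rewrite (@eq_nrm2 _ _ _ _ _ _ (fun x => partial i (psi j) x - partial i (psi l) x)).
    exact: near2 (psqi i (spsi j)) (psqi i (spsi l)) (sdv i) (dpsiv i j) (dpsiv i l).
  by move=> x _; rewrite partial_lin// mul1r mulN1r.
(* Fatou as j tends to infinity with l fixed; the bound B (2^-j + 2^-l) tends to B 2^-l. *)
have u3v l : intg (fun x => `|u x| ^+ 3 * `|v x - psi l x|) /\
    int (fun x => `|u x| ^+ 3 * `|v x - psi l x|) <= B * 2^-1 ^+ l.
  have mpsi := smooth_measurable (spsi l) : measurable_fun Omega (psi l).
  apply: (@fatou_ae _ _ _ _ _ mOmega
    (fun j x => `|u x| ^+ 3 * `|1 * psi j x + -1 * psi l x|) _
    (fun j => B * (2^-1 ^+ j + 2^-1 ^+ l))).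
  - by move=> j; apply: limit_abs_pow3M; exact: is_smooth_lin.
  - apply: measurable_funM; first exact: intg_measurable limit_abs_pow3.
    by apply: measurableT_comp => //; apply: measurable_funB => //; exact: sv.1.
  - by move=> j x _; rewrite mulr_ge0 ?exprn_ge0.
  - by move=> x _; rewrite mulr_ge0 ?exprn_ge0.
  - apply: filterS ae_v => x /[apply] vx; apply: cvgM; first exact: cvg_cst.
    apply: cvg_norm; under eq_fun do rewrite mul1r mulN1r.
    by apply: cvgB => //; exact: cvg_cst.
  - by move=> j; apply: le_trans (kato_le _) (kB j l); exact: Cc_smooth_lin.
  - apply: cvgM; first exact: cvg_cst.
    rewrite -[X in _ --> X]add0r; apply: cvgD => //; exact: cvg_cst.
have u3psi l : intg (fun x => u x ^+ 3 * psi l x).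
  have [M [_ psiM]] := smooth_bounded bOmega (spsi l).
  exact: limit_pow3M_intg (smooth_measurable (spsi l)) psiM.
have vi : intg (fun x => u x ^+ 3 * v x).
  apply: (le_intg mOmega _ _ (intgD mOmega (u3v 0).1 (limit_abs_pow3M (spsi 0)))).
    by apply: measurable_funM; [exact: measurable_funX|exact: sv.1].
  move=> x _; rewrite -mulrDr normrM normrX ler_wpM2l ?exprn_ge0//.
  by rewrite -[X in `|X| <= _](subrK (psi 0 x)) ler_normD.
split => //.
have cu3 : (fun l => int (fun x => u x ^+ 3 * psi l x)) @ \oo -->
    int (fun x => u x ^+ 3 * v x).
  apply: (@cvg_dist_le _ _ (fun l => B * 2^-1 ^+ l)); last exact: cvg_half_exp.
  move=> l; rewrite distrC -(RintegralB mOmega vi (u3psi l)).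
  apply: le_trans (le_normr_Rintegral mOmega (intgB mOmega vi (u3psi l))) _.
  apply: le_trans (u3v l).2.
  rewrite le_eqVlt; apply/orP; left; apply/eqP; apply: eq_Rintegral => x _.
  by rewrite -mulrBr normrM normrX.
have cpsi w : sqi w -> (fun l => int (fun x => w x * psi l x)) @ \oo -->
    int (fun x => w x * v x).
  move=> sw; under eq_fun do under eq_Rintegral do rewrite mulrC.
  rewrite (_ : Rintegral _ _ _ = int (fun x => v x * w x)); last first.
    by apply: eq_Rintegral => x _; rewrite mulrC.
  apply: (cvg_int_nrm2 mOmega (fun l => ssqi (spsi l)) sv sw).
  apply: (@cvg_dist_le _ _ (fun k => 2^-1 ^+ k)) => // k.
  by rewrite subr0 ger0_norm ?nrm2_ge0.
have cdpsi i : (fun l => int (fun x => g i x * partial i (psi l) x)) @ \oo -->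
    int (fun x => g i x * weak_partial v i x).
  under eq_fun do under eq_Rintegral do rewrite mulrC.
  rewrite (_ : Rintegral _ _ _ = int (fun x => weak_partial v i x * g i x)); last first.
    by apply: eq_Rintegral => x _; rewrite mulrC.
  apply: (cvg_int_nrm2 mOmega (fun l => psqi i (spsi l)) (sdv i) (sg i)).
  apply: (@cvg_dist_le _ _ (fun k => 2^-1 ^+ k)) => // k.
  by rewrite subr0 ger0_norm ?nrm2_ge0.
apply: cvg_seq_unique (cpsi f sf).
under eq_fun do rewrite -weak_equation//.
apply: cvgD => //; apply: cvgB; first exact: cvg_sum_seq.
by apply: cvgM; [exact: cvg_cst|exact: cpsi].
Qed.

End weak_solution.

Unset Implicit Arguments.

Theorem mainTheorem1 (R : realType) (n : nat) (hn : (n <= 4)%N)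
    (Omega : set 'rV[R]_n) (Omega_open : open Omega)
    (Omega_bounded : bounded_set Omega)
    (f : 'rV[R]_n -> R) (f_L2 : L2 Omega f)
    (lambda : R) (lambda_lt : (lambda%:E < lambda1 Omega)%E) :
  exists2 u : H1 Omega, H10 u &
    forall v : H1 Omega, H10 v ->
      (lebesgue_rV n).-integrable Omega (fun x => (u x ^+ 3 * v x)%:E) /\
      \int[lebesgue_rV n]_(x in Omega)
          (\sum_(i < n) weak_partial u i x * weak_partial v i x)
        - lambda * \int[lebesgue_rV n]_(x in Omega) (u x * v x)
        + \int[lebesgue_rV n]_(x in Omega) (u x ^+ 3 * v x)
      = \int[lebesgue_rV n]_(x in Omega) (f x * v x).
Proof.
have mOmega := open_measurable_rV Omega_open.
have sf : sqi (lebesgue_rV n) Omega f by apply/(L2_sqi mOmega).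
have [phi [u [g [C [K4 [Cphi [su sg] ae_u [phi_u phi_g] [phi4 dJ0]]]]]]] :=
  weak_limit Omega_open Omega_bounded sf lambda_lt.
have Lu : L2 Omega u by apply/(L2_sqi mOmega).
have Lg i : L2 Omega (g i) by apply/(L2_sqi mOmega).
have wg := limit_weak_partial Omega_open Omega_bounded Cphi su sg phi_u phi_g.
exists (MkH1 Lu Lg wg).
  move=> e /(limit_H1_norm_small phi_u phi_g)[k ke].
  by exists (phi k).
move=> v v0.
have [ui <-] := H10_weak_equation Omega_open Omega_bounded sf Cphi su sg ae_u
  phi_u phi_g phi4 dJ0 v0.
split; first exact: ui.
(* The equation was obtained with the sum over i outside the integral; it is moved inside using the
   integrability of each product of weak derivatives. *)
congr (_ - _ + _); apply: Rintegral_sum => // i.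
by apply: sqi_mul => //; apply/(L2_sqi mOmega); exact: weak_partial_L2.
Qed.
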